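(* The mixed integer program BRP-m3 can be simplified without sacrificing its correctness by the following three modifications: (a) relax the integer variables $x_{ij}^t$ and $u_i^t$ to continuous ones ($x_{ij}^t\in[0,1]$, $u_i^t\in[1,H]$); (b) eliminate the constraints ($\hat{\mathrm y}$3), (z1) and (z2); (c) add the equalities - (e1) $z_{1i}^t=\hat y_{j1}^t$ for the $i\in\mathbb{B}'$ with $C_{1i}=1$, the $j\in\mathbb{B}$ with $C_{j1}=1$, and all $t\in\mathbb{T}$; - (e2) $\sum_{t\in\mathbb{T}}\hat y_{i1}^t=1$ for the $i\in\mathbb{B}$ with $C_{i1}=1$; - (e3) $\check y_{i1}^t=0$ for $i\in\mathbb{B}\setminus\{1\}$, $t\in\mathbb{T}$; - (e4) $x_{i1}^t=\hat y_{i1}^t=0$ for $i\in\mathbb{B}\setminus\{1\}$ with $C_{i1}=0$, $t\in\mathbb{T}$; - (e5) $\hat y_{1i}^t=\check y_{1i}^t=0$ for $i\in\mathbb{B}'\setminus\{1\}$, $t\in\mathbb{T}$; - (e6) $x_{1i}^t=z_{1i}^t=0$ for $i\in\mathbb{B}'\setminus\{1\}$ with $C_{1i}=0$, $t\in\mathbb{T}$; - (e7) $u_1^t=h_1$ for $t\in\mathbb{T}$. That is, the modified model is still an exact formulation of the block relocation problem: its optimal value equals that of BRP-m3 (the minimum number of relocations), and its optimal solutions encode optimal move sequences.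
   Context: Block relocation problem (BRP). Blocks $\mathbb{B}=\{1,\dots,B\}$ (smaller label = higher priority) are piled on $S$ stacks with height limit $H$ (at most $H$ blocks per stack). A relocation moves the topmost block of a stack onto a different stack (respecting the height limit). A retrieval removes the block of smallest remaining label, allowed only when it is topmost. The goal is to retrieve all blocks with the minimum number of relocations. No block is directly retrievable in the initial configuration (block $1$ is not topmost), and the instance is feasible. Notation. $\mathbb{B}'=\mathbb{B}\cup\{B+1\}$, where $B+1$ is a virtual block representing the floor of all stacks. $C_{ij}=1$ if initially block $i$ lies directly upon block $j$ (or on the floor if $j=B+1$), else $0$. $h_i$ is the height (tier number, bottom $=1$) of block $i$ in the initial configuration. $L$ is a lower bound and $T$ an upper bound on the minimum number of relocations, and $\mathbb{T}=\{1,\dots,T\}$. Turn $t$ consists of the $t$-th relocation and all subsequent retrievals before the next relocation; $0$ denotes the initial stage. Variables: $x_{ij}^t$ ($i\in\mathbb{B}$, $j\in\mathbb{B}'\setminus\{i\}$, $t\in\mathbb{T}\cup\{0\}$): $1$ iff block $i$ is directly upon $j$ at the end of turn $t$. $\hat y_{ij}^t$ (resp. $\check y_{ij}^t$) ($i\in\mathbb{B}$, $j\in\mathbb{B}'\setminus\{i\}$, $t\in\mathbb{T}$): $1$ iff in turn $t$ block $i$ is lifted up from directly upon $j$ (resp. put down directly upon $j$). $z_{ij}^t$ ($i\in\mathbb{B}$, $j\in\mathbb{B}'$, $j>i$, $t\in\mathbb{T}$): $1$ iff block $i$ is retrieved from the top of $j$ in turn $t$. $u_i^t$ ($i\in\mathbb{B}$,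 $t\in\mathbb{T}$): height of block $i$ just after the put-down in turn $t$. BRP-m3: minimize $\sum_{i\in\mathbb{B}}\sum_{j\in\mathbb{B}'\setminus\{i\}}\sum_{t\in\mathbb{T}}\check y_{ij}^t$ subject to (x1) $x_{ij}^0=C_{ij}$ for $i\in\mathbb{B}$, $j\in\mathbb{B}'\setminus\{i\}$; (x2) $x_{ij}^t=x_{ij}^{t-1}-\hat y_{ij}^t+\check y_{ij}^t$ for $i\in\mathbb{B}$, $j\in\mathbb{B}'$, $j<i$, $t\in\mathbb{T}$; (x3) $x_{ij}^t=x_{ij}^{t-1}-\hat y_{ij}^t+\check y_{ij}^t-z_{ij}^t$ for $i\in\mathbb{B}$, $j\in\mathbb{B}'$, $j>i$, $t\in\mathbb{T}$; (x4) $x_{ij}^T=0$ for $i\in\mathbb{B}$, $j\in\mathbb{B}'\setminus\{i\}$; (x5) $x_{ij}^t\in\{0,1\}$; ($\hat{\mathrm y}$1) $\sum_{i\in\mathbb{B}}\sum_{j\in\mathbb{B}'\setminus\{i\}}\hat y_{ij}^t=1$ for $t\in\mathbb{T}$, $t\le L$; ($\hat{\mathrm y}$2) $\sum_{i\in\mathbb{B}}\sum_{j\in\mathbb{B}'\setminus\{i\}}\hat y_{ij}^t\le\sum_{i\in\mathbb{B}}\sum_{j\in\mathbb{B}'\setminus\{i\}}\hat y_{ij}^{t-1}$ for $t\in\mathbb{T}$, $t>L$; ($\hat{\mathrm y}$3) $\hat y_{ij}^t\le x_{ij}^{t-1}$ for $i\in\mathbb{B}$, $j\in\mathbb{B}'\setminus\{i\}$,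 $t\in\mathbb{T}$; ($\hat{\mathrm y}$4) $\sum_{j\in\mathbb{B}'\setminus\{i\}}\hat y_{ij}^t\le\sum_{j\in\mathbb{B}'\setminus\{i\}}x_{ij}^{t-1}-\sum_{j\in\mathbb{B}\setminus\{i\}}x_{ji}^{t-1}$ for $i\in\mathbb{B}$, $t\in\mathbb{T}$; ($\hat{\mathrm y}$5) $\hat y_{ij}^t\in\{0,1\}$; ($\check{\mathrm y}$1) $\sum_{j\in\mathbb{B}'\setminus\{i\}}\check y_{ij}^t=\sum_{j\in\mathbb{B}'\setminus\{i\}}\hat y_{ij}^t$ for $i\in\mathbb{B}$, $t\in\mathbb{T}$; ($\check{\mathrm y}$2) $\sum_{j\in\mathbb{B}\setminus\{i\}}\check y_{ji}^t\le\sum_{j\in\mathbb{B}'\setminus\{i\}}x_{ij}^{t-1}-\sum_{j\in\mathbb{B}\setminus\{i\}}\hat y_{ji}^t$ for $i\in\mathbb{B}$, $t\in\mathbb{T}$; ($\check{\mathrm y}$3) $\sum_{j\in\mathbb{B}}\check y_{j(B+1)}^t\le 1-\sum_{j\in\mathbb{B}}\hat y_{j(B+1)}^t$ for $t\in\mathbb{T}$; ($\check{\mathrm y}$4) $\sum_{j\in\mathbb{B}\setminus\{i\}}\check y_{ji}^t\le\sum_{j\in\mathbb{B}'\setminus\{i\}}x_{ij}^{t-1}-\sum_{j\in\mathbb{B}\setminus\{i\}}x_{ji}^{t-1}$ for $i\in\mathbb{B}$, $t\in\mathbb{T}$; ($\check{\mathrm y}$5) $\sum_{j\in\mathbb{B}}\check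 y_{j(B+1)}^t\le S-\sum_{j\in\mathbb{B}}x_{j(B+1)}^{t-1}$ for $t\in\mathbb{T}$; ($\check{\mathrm y}$6) $\check y_{ij}^t\in\{0,1\}$; (z1) $z_{ij}^t\le x_{ij}^{t-1}-\hat y_{ij}^t+\check y_{ij}^t$ for $i\in\mathbb{B}$, $j\in\mathbb{B}'$, $j>i$, $t\in\mathbb{T}$; (z2) $\sum_{j\in\mathbb{B}',j>i}z_{ij}^t\le\sum_{j\in\mathbb{B}'\setminus\{i\}}x_{ij}^{t-1}-\sum_{j\in\mathbb{B},j>i}(x_{ji}^{t-1}-\hat y_{ji}^t+\check y_{ji}^t)$ for $i\in\mathbb{B}$, $t\in\mathbb{T}$; (z3) $\sum_{j\in\mathbb{B}',j>i}\sum_{\tau\in\mathbb{T},\tau\le t}z_{ij}^\tau\le\sum_{j\in\mathbb{B}',j>i-1}\sum_{\tau\in\mathbb{T},\tau\le t}z_{(i-1)j}^\tau$ for $i\in\mathbb{B}\setminus\{1\}$, $t\in\mathbb{T}$; (z4) $z_{ij}^t\in\{0,1\}$; (u1) $u_i^t\ge u_j^t+1-H(1-x_{ij}^{t-1}+\hat y_{ij}^t-\check y_{ij}^t)$ for $i\in\mathbb{B}$, $j\in\mathbb{B}\setminus\{i\}$, $t\in\mathbb{T}$; (u2) $u_i^t\in\{1,\dots,H\}$ for $i\in\mathbb{B}$, $t\in\mathbb{T}$. *)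

(* Defs.v *)
From mathcomp Require Import all_boot all_order all_algebra.
Set Implicit Arguments.
Unset Strict Implicit.
Unset Printing Implicit Defensive.
Import Order.TTheory GRing.Theory Num.Theory.


Section Problem.
Variable S : nat.

(* A stack is the list of its block labels from top to bottom. *)
Definition config := {ffun 'I_S -> seq nat}.

Definition blocks (c : config) : seq nat := flatten [seq c s | s : 'I_S].

(* [Reloc s d] moves the top block of [s] onto [d]; [Retr s] retrieves the top
   block of [s]. *)
Inductive move := Reloc of 'I_S & 'I_S | Retr of 'I_S.

Definition is_reloc (m : move) : bool := if m is Reloc _ _ then true else false.

Definition nreloc (ms : seq move) : nat := count is_reloc ms.

Definition legal (H : nat) (c : config) (m : move) : bool :=
  match m with
  | Reloc s d => [&& s != d, c s != [::] & size (c d) < H]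
  | Retr s => if c s is b :: _ then all (leq b) (blocks c) else false
  end.

(* Only meaningful for legal moves. *)
Definition act (c : config) (m : move) : config :=
  match m with
  | Reloc s d => [ffun r => if r == s then behead (c s)
                            else if r == d then take 1 (c s) ++ c d else c r]
  | Retr s => [ffun r => if r == s then behead (c s) else c r]
  end.

Definition run (c : config) (ms : seq move) : config := foldl act c ms.

Fixpoint valid (H : nat) (c : config) (ms : seq move) : bool :=
  if ms is m :: ms' then legal H c m && valid H (act c m) ms' else true.

Definition solves (H : nat) (c : config) (ms : seq move) : Prop :=
  valid H c ms /\ blocks (run c ms) = [::].

Definition solvable (H : nat) (c : config) : Prop :=
  exists ms, solves H c ms.

Definition optimal_moves (H : nat) (c : config) (ms : seq move) : Prop :=
  solves H c ms /\ forall ms', solves H c ms' -> nreloc ms <= nreloc ms'.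

Definition min_relocations (H : nat) (c : config) (K : nat) : Prop :=
  exists2 ms, optimal_moves H c ms & nreloc ms = K.

(* An initial configuration: the blocks are exactly 1, ..., B, each once, the
   height limit holds, and no block is directly retrievable. *)
Definition initial (B H : nat) (c : config) : Prop :=
  [/\ perm_eq (blocks c) (iota 1 B),
      forall s, size (c s) <= H
    & forall s, ~~ legal H c (Retr s)].

(* Block [i] lies directly upon [j], the label [B.+1] standing for the floor of
   every stack. *)
Definition upon (B : nat) (c : config) (i j : nat) : bool :=
  [exists s, infix [:: i; j] (rcons (c s) B.+1)].

(* Tier number of block [i], the bottom tier being 1. *)
Definition height (c : config) (i : nat) : nat :=
  \sum_(s | i \in c s) (size (c s) - index i (c s)).

(* A turn is at most one relocation followed by retrievals; turns without a
   relocation are needed because a model has a fixed number [T] of turns. *)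
Record turn := Turn { t_reloc : option ('I_S * 'I_S); t_retr : seq 'I_S }.

Definition turn_moves (tn : turn) : seq move :=
  (if t_reloc tn is Some (s, d) then [:: Reloc s d] else [::])
    ++ [seq Retr s | s <- t_retr tn].

Definition plan_moves (p : seq turn) : seq move :=
  flatten [seq turn_moves tn | tn <- p].

(* The configuration at the end of turn [t] (the initial one for [t = 0]). *)
Definition state (c : config) (p : seq turn) (t : nat) : config :=
  run c (plan_moves (take t p)).

(* Turn [t] is item [t.-1] of a plan. *)
Definition nth_turn (p : seq turn) (t : nat) : turn :=
  nth (Turn None [::]) p t.-1.

(* The configuration just after the put-down (if any) of turn [t]. *)
Definition mid_state (c : config) (p : seq turn) (t : nat) : config :=
  if t_reloc (nth_turn p t) is Some (s, d)
  then act (state c p t.-1) (Reloc s d) else state c p t.-1.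

Definition relocated (c : config) (p : seq turn) (t i : nat) : bool :=
  if t_reloc (nth_turn p t) is Some (s, _)
  then ohead (state c p t.-1 s) == Some i else false.

Definition lifted B (c : config) (p : seq turn) (i j t : nat) : bool :=
  relocated c p t i && upon B (state c p t.-1) i j.

Definition put_down B (c : config) (p : seq turn) (i j t : nat) : bool :=
  relocated c p t i && upon B (mid_state c p t) i j.

Definition retrieved B (c : config) (p : seq turn) (i j t : nat) : bool :=
  upon B (mid_state c p t) i j && (i \notin blocks (state c p t)).

End Problem.


Local Open Scope ring_scope.

(* [xv v i j t], [yhat v i j t], [ychk v i j t], [zv v i j t], [uv v i t] have
   the block labels first and the turn last.  All indices start from 1 (except
   that [xv] also has turn 0); values outside the index ranges are never
   mentioned. *)
Record vars (R : Type) := Vars {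
  xv : nat -> nat -> nat -> R;
  yhat : nat -> nat -> nat -> R;
  ychk : nat -> nat -> nat -> R;
  zv : nat -> nat -> nat -> R;
  uv : nat -> nat -> R }.

(* [idx n] is {1, ..., n}: [idx B] for the blocks, [idx B.+1] for the blocks
   and the floor, [idx T] for the turns. *)
Definition idx (n i : nat) : bool := (0 < i <= n)%N.

Definition binary (R : realFieldType) (r : R) : Prop := r = 0 \/ r = 1.

Section Models.
Variables (R : realFieldType) (B S H L T : nat).
Variables (C : rel nat) (h : nat -> nat).
Variable v : vars R.

Local Notation x := (xv v).
Local Notation yh := (yhat v).
Local Notation yc := (ychk v).
Local Notation z := (zv v).
Local Notation u := (uv v).

Definition objective : R :=
  \sum_(1 <= i < B.+1) \sum_(1 <= j < B.+2 | j != i) \sum_(1 <= t < T.+1)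
    yc i j t.

Record core_constraints : Prop := {
  c_x1 : forall i j, idx B i -> idx B.+1 j -> j != i ->
    x i j 0%N = (C i j)%:R;
  c_x2 : forall i j t, idx B i -> idx B.+1 j -> (j < i)%N -> idx T t ->
    x i j t = x i j t.-1 - yh i j t + yc i j t;
  c_x3 : forall i j t, idx B i -> idx B.+1 j -> (i < j)%N -> idx T t ->
    x i j t = x i j t.-1 - yh i j t + yc i j t - z i j t;
  c_x4 : forall i j, idx B i -> idx B.+1 j -> j != i -> x i j T = 0;

  c_yh1 : forall t, idx T t -> (t <= L)%N ->
    \sum_(1 <= i < B.+1) \sum_(1 <= j < B.+2 | j != i) yh i j t = 1;
  c_yh2 : forall t, idx T t -> (L < t)%N ->
    \sum_(1 <= i < B.+1) \sum_(1 <= j < B.+2 | j != i) yh i j t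
    <= \sum_(1 <= i < B.+1) \sum_(1 <= j < B.+2 | j != i) yh i j t.-1;
  c_yh4 : forall i t, idx B i -> idx T t ->
    \sum_(1 <= j < B.+2 | j != i) yh i j t
    <= \sum_(1 <= j < B.+2 | j != i) x i j t.-1
       - \sum_(1 <= j < B.+1 | j != i) x j i t.-1;
  c_yh5 : forall i j t, idx B i -> idx B.+1 j -> j != i -> idx T t ->
    binary (yh i j t);

  c_yc1 : forall i t, idx B i -> idx T t ->
    \sum_(1 <= j < B.+2 | j != i) yc i j t
    = \sum_(1 <= j < B.+2 | j != i) yh i j t;
  c_yc2 : forall i t, idx B i -> idx T t ->
    \sum_(1 <= j < B.+1 | j != i) yc j i t
    <= \sum_(1 <= j < B.+2 | j != i) x i j t.-1
       - \sum_(1 <= j < B.+1 | j != i) yh j i t;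
  c_yc3 : forall t, idx T t ->
    \sum_(1 <= j < B.+1) yc j B.+1 t
    <= 1 - \sum_(1 <= j < B.+1) yh j B.+1 t;
  c_yc4 : forall i t, idx B i -> idx T t ->
    \sum_(1 <= j < B.+1 | j != i) yc j i t
    <= \sum_(1 <= j < B.+2 | j != i) x i j t.-1
       - \sum_(1 <= j < B.+1 | j != i) x j i t.-1;
  c_yc5 : forall t, idx T t ->
    \sum_(1 <= j < B.+1) yc j B.+1 t
    <= S%:R - \sum_(1 <= j < B.+1) x j B.+1 t.-1;
  c_yc6 : forall i j t, idx B i -> idx B.+1 j -> j != i -> idx T t ->
    binary (yc i j t);

  c_z3 : forall i t, idx B i -> i != 1%N -> idx T t ->
    \sum_(1 <= j < B.+2 | (i < j)%N) \sum_(1 <= tau < T.+1 | (tau <= t)%N)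
      z i j tau
    <= \sum_(1 <= j < B.+2 | (i.-1 < j)%N)
         \sum_(1 <= tau < T.+1 | (tau <= t)%N) z i.-1 j tau;
  c_z4 : forall i j t, idx B i -> idx B.+1 j -> (i < j)%N -> idx T t ->
    binary (z i j t);

  c_u1 : forall i j t, idx B i -> idx B j -> j != i -> idx T t ->
    u i t >= u j t + 1 - H%:R * (1 - x i j t.-1 + yh i j t - yc i j t)
}.

Record redundant_constraints : Prop := {
  c_yh3 : forall i j t, idx B i -> idx B.+1 j -> j != i -> idx T t ->
    yh i j t <= x i j t.-1;
  c_z1 : forall i j t, idx B i -> idx B.+1 j -> (i < j)%N -> idx T t ->
    z i j t <= x i j t.-1 - yh i j t + yc i j t;
  c_z2 : forall i t, idx B i -> idx T t ->
    \sum_(1 <= j < B.+2 | (i < j)%N) z i j t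
    <= \sum_(1 <= j < B.+2 | j != i) x i j t.-1
       - \sum_(1 <= j < B.+1 | (i < j)%N) (x j i t.-1 - yh j i t + yc j i t)
}.

Record integral_domains : Prop := {
  c_x5 : forall i j t, idx B i -> idx B.+1 j -> j != i -> (t <= T)%N ->
    binary (x i j t);
  c_u2 : forall i t, idx B i -> idx T t ->
    exists2 k : nat, idx H k & u i t = k%:R
}.

Record relaxed_domains : Prop := {
  c_x5' : forall i j t, idx B i -> idx B.+1 j -> j != i -> (t <= T)%N ->
    0 <= x i j t <= 1;
  c_u2' : forall i t, idx B i -> idx T t -> 1 <= u i t <= H%:R
}.

Record block1_equalities : Prop := {
  c_e1 : forall i j t, idx B.+1 i -> C 1%N i -> idx B j -> C j 1%N ->
    idx T t -> z 1%N i t = yh j 1%N t;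
  c_e2 : forall i, idx B i -> C i 1%N ->
    \sum_(1 <= t < T.+1) yh i 1%N t = 1;
  c_e3 : forall i t, idx B i -> i != 1%N -> idx T t -> yc i 1%N t = 0;
  c_e4 : forall i t, idx B i -> i != 1%N -> ~~ C i 1%N -> idx T t ->
    x i 1%N t = 0 /\ yh i 1%N t = 0;
  c_e5 : forall i t, idx B.+1 i -> i != 1%N -> idx T t ->
    yh 1%N i t = 0 /\ yc 1%N i t = 0;
  c_e6 : forall i t, idx B.+1 i -> i != 1%N -> ~~ C 1%N i -> idx T t ->
    x 1%N i t = 0 /\ z 1%N i t = 0;
  c_e7 : forall t, idx T t -> u 1%N t = (h 1%N)%:R
}.

Definition brp_m3 : Prop :=
  [/\ core_constraints, redundant_constraints & integral_domains].

Definition brp_m3_simplified : Prop :=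
  [/\ core_constraints, relaxed_domains & block1_equalities].

End Models.

Definition optimal_for (R : realFieldType) (P : vars R -> Prop)
    (f : vars R -> R) (v : vars R) : Prop :=
  P v /\ forall w, P w -> f v <= f w.

Definition optimal_value (R : realFieldType) (P : vars R -> Prop)
    (f : vars R -> R) (r : R) : Prop :=
  exists2 v, optimal_for P f v & f v = r.

(* The variables [u] are left out: the models only bound them below by the
   heights, they do not determine them. *)
Definition encodes (R : realFieldType) (B S T : nat) (c : config S)
    (v : vars R) (p : seq (turn S)) : Prop :=
  size p = T /\
  forall i j, idx B i -> idx B.+1 j -> j != i ->
    (forall t, (t <= T)%N -> xv v i j t = (upon B (state c p t) i j)%:R) /\
    (forall t, idx T t ->
      [/\ yhat v i j t = (lifted B c p i j t)%:R,
          ychk v i j t = (put_down B c p i j t)%:R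
        & (i < j)%N -> zv v i j t = (retrieved B c p i j t)%:R]).

(* Main.v *)
(** The modified model still determines everything that was dropped from BRP-m3.
    The [x] variables start at 0/1 values and change by integers, so they stay
    0/1; the constraints on [u] bound the length of every chain of blocks by
    [H], so [u] may be fractional.  (ŷ3) follows from (y̌2) and (y̌3), because a
    block cannot be put down where it was lifted from, and (z1) from the
    nonnegativity of [x].  If (z2) failed, a block would be left upon a retrieved
    one; by (y̌2) it could never be lifted again, against (x4).  Hence every
    feasible point encodes a plan with as many relocations as its objective.

    Conversely an optimal plan gives a feasible point of both models.  It never
    moves a lone block onto an empty stack, which would only rename two stacks,
    and it may be assumed to retrieve block 1 as soon as it is uncovered: the
    moves of the other blocks stay legal when a block is deleted. *)

Require Import Defs.
From mathcomp Require Import all_boot all_order all_algebra fingroup.perm.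
From mathcomp Require Import zify lra.
From Stdlib Require Import Classical.
Set Implicit Arguments.
Unset Strict Implicit.
Unset Printing Implicit Defensive.
Import Order.TTheory GRing.Theory Num.Theory.

(** * Sums and configurations *)

Section SumBool.
Variables (I : eqType).
Implicit Types (r : seq I) (P : pred I).

Lemma sum_gt0P r P (f : I -> nat) :
  reflect (exists i, [/\ i \in r, P i & 0 < f i]) (0 < \sum_(i <- r | P i) f i).
Proof.
rewrite lt0n sum_nat_seq_neq0; apply: (iffP hasP) => [[i ir /andP[Pi fi]]|[i [ir Pi fi]]].
  by exists i; rewrite lt0n.
by exists i; rewrite // Pi -lt0n.
Qed.

Lemma sum_le1_eq r P (f : I -> nat) i i' : \sum_(i <- r | P i) f i <= 1 ->
  i \in r -> P i -> 0 < f i -> i' \in r -> P i' -> 0 < f i' -> i = i'.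
Proof.
move=> le1 ir Pi fi ir' Pi' fi'; apply/eqP/negPn/negP => nii'.
move: le1; rewrite (perm_big _ (perm_to_rem ir)) big_cons Pi.
have : 0 < \sum_(k <- rem i r | P k) f k.
  apply/sum_gt0P; exists i'; split=> //.
  move: ir'; rewrite (perm_mem (perm_to_rem ir)) inE => /orP[/eqP e|//].
  by rewrite e eqxx in nii'.
by rewrite /=; move: (\sum_(k <- _ | _) _) => s; lia.
Qed.

Lemma sum_bool r P (b : pred I) : uniq r ->
  (forall i i', i \in r -> i' \in r -> P i -> P i' -> b i -> b i' -> i = i') ->
  \sum_(i <- r | P i) (b i : nat) = has (fun i => P i && b i) r.
Proof.
move=> ur inj; case: (boolP (has _ _)) => [/hasP[i ir /andP[Pi bi]]|/hasPn nh].
  rewrite big_mkcond (bigD1_seq i) //= Pi bi big1_seq ?addn0 // => k /andP[nk kr].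
  case: ifP => // Pk; case bk: (b k) => //.
  by rewrite (inj k i) ?eqxx // in nk.
by rewrite big1_seq // => i /andP[Pi /nh]; rewrite Pi /=; case: (b i).
Qed.

End SumBool.

Section Configurations.
Variables (B S : nat).
Implicit Types (k : config S) (s d : 'I_S) (i j b : nat).

Definition wf k : Prop :=
  [/\ forall s, uniq (k s),
      forall s s' i, i \in k s -> i \in k s' -> s = s'
    & forall s i, i \in k s -> idx B i].

Lemma mem_blocksP k i : reflect (exists s, i \in k s) (i \in blocks k).
Proof.
apply: (iffP flattenP) => [[q /mapP[s _ ->] iq]|[s iq]]; first by exists s.
by exists (k s) => //; apply/mapP; exists s; rewrite // mem_enum.
Qed.

Lemma blocks_nilP k : reflect (forall s, k s = [::]) (blocks k == [::]).
Proof.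
apply: (iffP eqP) => e => [s|].
  case q: (k s) => [//|i w]; suff: i \in blocks k by rewrite e.
  by apply/mem_blocksP; exists s; rewrite q mem_head.
case q: (blocks k) => [//|i w].
have /mem_blocksP[s]: i \in blocks k by rewrite q mem_head.
by rewrite e.
Qed.

Lemma initial_wf H k : initial B H k -> wf k.
Proof.
case=> pe _ _; have ub : uniq (blocks k) by rewrite (perm_uniq pe) iota_uniq.
have cnt i : count_mem i (blocks k) = \sum_(s : 'I_S) count_mem i (k s).
  by rewrite /blocks count_flatten sumnE big_map big_image.
split=> [s|s s' i is1 is2|s i iks].
- apply/count_mem_uniq => i; apply/eqP; rewrite eqn_leq; apply/andP; split.
    have : count_mem i (blocks k) <= 1 by rewrite count_uniq_mem // leq_b1.
    rewrite cnt (bigD1 s) //=; case: (boolP (i \in k s)) => [_ |/count_memPn ->//].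
    by move=> h; apply: leq_trans h; apply: leq_addr.
  by case: (boolP (i \in k s)); rewrite // -has_pred1 has_count.
- apply/eqP/negPn/negP => ns.
  have : count_mem i (blocks k) <= 1 by rewrite count_uniq_mem // leq_b1.
  rewrite cnt (bigD1 s) //= (bigD1 s') /=; last by rewrite eq_sym.
  move: is1 is2; rewrite -!has_pred1 !has_count /= => h1 h2.
  by move: (\sum_(_ < _ | _) _) => n; move: h1 h2; lia.
- have: i \in blocks k by apply/mem_blocksP; exists s.
  by rewrite (perm_mem pe) mem_iota /idx; lia.
Qed.

Lemma idx_blocks k i : wf k -> i \in blocks k -> idx B i.
Proof. by case=> _ _ h /mem_blocksP[s] /h. Qed.

Lemma uponP k i j : wf k ->
  reflect (exists2 s, i \in k s & j = nth B.+1 (k s) (index i (k s)).+1)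
          (upon B k i j).
Proof.
case=> uk _ ik.
have uF s : uniq (rcons (k s) B.+1).
  rewrite rcons_uniq uk andbT; apply/negP => /ik; rewrite /idx; lia.
apply: (iffP existsP) => [[s /infixP[w1 [w2 e]]]|[s iks ->]].
  have {}e : rcons (k s) B.+1 = w1 ++ [:: i, j & w2] by rewrite e.
  have := uF s; rewrite e cat_uniq /= !negb_or => /and3P[_ /and3P[iw _ _] _].
  have iks : i \in k s.
    have := lastI i (j :: w2); move: e; case/lastP: w2 => [|w2 x].
      by rewrite -[w1 ++ _]/(w1 ++ rcons [:: i] j) -rcons_cat => /rcons_inj[-> _];
         rewrite mem_cat mem_head orbT.
    by rewrite -2!rcons_cons -rcons_cat => /rcons_inj[-> _];
       rewrite mem_cat mem_head orbT.
  exists s => //.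
  have nthE n : nth B.+1 (rcons (k s) B.+1) n = nth B.+1 (k s) n.
    by rewrite nth_rcons; case: ltngtP => // h; rewrite nth_default ?h // ltnW.
  rewrite -nthE.
  have -> : index i (k s) = size w1.
    have : index i (rcons (k s) B.+1) = size w1.
      by rewrite e index_cat (negPf iw) /= eqxx addn0.
    by rewrite -cats1 index_cat iks.
  by rewrite e nth_cat ltnNge leqnSn /= subSnn.
exists s; apply/infixP.
set n := index i (k s); have ltn : n < size (k s) by rewrite index_mem.
exists (take n (k s)), (drop n.+2 (rcons (k s) B.+1)).
rewrite -{1}(cat_take_drop n (rcons (k s) B.+1)) -cats1 takel_cat 1?ltnW //.
congr (_ ++ _); rewrite cats1.
rewrite (drop_nth B.+1) ?size_rcons ?(ltn_trans ltn) //.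
rewrite (drop_nth B.+1) ?size_rcons //=.
rewrite !nth_rcons ltn nth_index //.
by case: ltngtP => // h; rewrite nth_default ?h // ltnW.
Qed.

Lemma upon_mem k i j : wf k -> upon B k i j -> i \in blocks k.
Proof. by move=> wk /(uponP _ _ wk)[s iks _]; apply/mem_blocksP; exists s. Qed.

Lemma upon_memr k i j : wf k -> upon B k i j -> j = B.+1 \/ j \in blocks k.
Proof.
move=> wk /(uponP _ _ wk)[s iks ->].
case: (leqP (size (k s)) (index i (k s)).+1) => h.
  by left; rewrite nth_default.
by right; apply/mem_blocksP; exists s; rewrite mem_nth.
Qed.

Lemma upon_idx k i j : wf k -> upon B k i j -> idx B i /\ idx B.+1 j.
Proof.
move=> wk u; split; first by exact: idx_blocks wk (upon_mem wk u).
by case: (upon_memr wk u) => [->|/(idx_blocks wk)]; rewrite /idx; lia.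
Qed.

Lemma upon_fun k i j j' : wf k -> upon B k i j -> upon B k i j' -> j = j'.
Proof.
move=> wk /(uponP _ _ wk)[s iks ->] /(uponP _ _ wk)[s' iks' ->].
by case: wk => _ disj _; rewrite (disj _ _ _ iks iks').
Qed.

Lemma upon_index k i j s : wf k -> upon B k i j -> j <= B -> j \in k s ->
  i \in k s /\ index j (k s) = (index i (k s)).+1.
Proof.
move=> wk /(uponP _ _ wk)[s' iks' ->].
case: (leqP (size (k s')) (index i (k s')).+1) => h.
  by rewrite nth_default // ltnn.
case: wk => uk disj _ _ jks.
have e : s' = s by apply: disj jks; rewrite mem_nth.
by rewrite -e iks' index_uniq.
Qed.

Lemma upon_inj k i i' j : wf k -> j <= B ->
  upon B k i j -> upon B k i' j -> i = i'.
Proof.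
move=> wk jB u u'.
case: (upon_memr wk u) => [e|/mem_blocksP[s jks]]; first by rewrite e ltnn in jB.
have [iks e] := upon_index wk u jB jks.
have [iks' e'] := upon_index wk u' jB jks.
rewrite -[i](nth_index 0 iks) -[RHS](nth_index 0 iks'); congr nth.
by move: e'; rewrite e => -[].
Qed.

Lemma upon_neq k i j : wf k -> upon B k i j -> j != i.
Proof.
move=> wk u; apply/eqP => e; rewrite e in u.
have ib := upon_mem wk u; have /mem_blocksP[s iks] := ib.
have iB : i <= B by have := idx_blocks wk ib; rewrite /idx; lia.
by have [_] := upon_index wk u iB iks; lia.
Qed.

Lemma ex_upon k i : wf k -> i \in blocks k -> exists j, upon B k i j.
Proof.
move=> wk /mem_blocksP[s iks]; eexists.
by apply/(uponP _ _ wk); exists s.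
Qed.

Lemma top_not_upon k s b w i : wf k -> k s = b :: w -> ~~ upon B k i b.
Proof.
move=> wk e; apply/negP => u.
have bs : b \in k s by rewrite e mem_head.
have bB : b <= B by case: wk => _ _ /(_ _ _ bs); rewrite /idx; lia.
by have [_] := upon_index wk u bB bs; rewrite e /= eqxx.
Qed.

Lemma topP k b : wf k -> b \in blocks k -> (forall i, ~~ upon B k i b) ->
  exists s w, k s = b :: w.
Proof.
move=> wk /mem_blocksP[s bs] nu; exists s, (behead (k s)).
case e: (k s) => [|x w]; first by rewrite e in bs.
case: (x =P b) => [->//|/eqP nxb]; exfalso.
have [n en]: exists n, index b (k s) = n.+1.
  by exists (index b w); rewrite e /= (negPf nxb).
have ln : n.+1 < size (k s) by rewrite -en index_mem.
apply/negP: (nu (nth 0 (k s) n)); rewrite negbK; apply/(uponP _ _ wk).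
exists s; first by rewrite mem_nth // ltnW.
case: wk => uk _ _.
by rewrite index_uniq ?(ltnW ln) // (set_nth_default 0) // -en nth_index.
Qed.

End Configurations.

(** * Legal moves *)

Section Moves.
Variables (B S : nat).
Implicit Types (k : config S) (s d : 'I_S) (i j b : nat).

Section Relocation.
Variables (k : config S) (s d : 'I_S) (b : nat) (w : seq nat).
Hypotheses (wk : wf B k) (ks : k s = b :: w) (sd : s != d).
Let k' := act k (Reloc s d).

Let k's : k' s = w. Proof. by rewrite ffunE eqxx ks. Qed.

Let k'd : k' d = b :: k d.
Proof. by rewrite ffunE eq_sym (negPf sd) eqxx ks /= take0. Qed.

Let k'r r : r != s -> r != d -> k' r = k r.
Proof. by rewrite ffunE => /negPf -> /negPf ->. Qed.

Let b_notin r : r != s -> b \notin k r.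
Proof.
apply: contraNN => br; case: wk => _ disj _; apply/eqP/esym; apply: disj br.
by rewrite ks mem_head.
Qed.

Let b_notin_w : b \notin w.
Proof. by case: wk => /(_ s); rewrite ks => /andP[]. Qed.

Let mem_reloc r i : i \in k' r =
  if i == b then r == d else i \in k r.
Proof.
have [->|nrs] := eqVneq r s.
  rewrite k's (negPf sd) ks inE.
  by have [->|_] := eqVneq i b; rewrite ?(negPf b_notin_w).
have [->|nrd] := eqVneq r d.
  by rewrite k'd inE; case: eqVneq.
by rewrite k'r //; case: eqVneq => // ->; rewrite (negPf (b_notin nrs)).
Qed.

Lemma mem_blocks_reloc i : (i \in blocks k') = (i \in blocks k).
Proof.
apply/mem_blocksP/mem_blocksP => [[r]|[r ir]].
  rewrite mem_reloc; have [-> _|_ ?] := eqVneq i b; last by exists r.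
  by exists s; rewrite ks mem_head.
have [->|nib] := eqVneq i b; first by exists d; rewrite k'd mem_head.
by exists r; rewrite mem_reloc (negPf nib).
Qed.

Lemma wf_reloc : wf B k'.
Proof.
case: (wk) => uk disj lab; split=> [r|r r' i|r i].
- have [->|nrs] := eqVneq r s.
    by rewrite k's; have := uk s; rewrite ks => /andP[].
  have [->|nrd] := eqVneq r d; last by rewrite k'r.
  by rewrite k'd /= uk b_notin // eq_sym.
- rewrite !mem_reloc; have [_ /eqP -> /eqP ->//|_] := eqVneq i b.
  exact: disj.
rewrite mem_reloc; have [-> _|_] := eqVneq i b; last exact: lab.
by apply: (lab s); rewrite ks mem_head.
Qed.

Lemma upon_reloc i j :
  upon B k' i j = if i == b then j == head B.+1 (k d) else upon B k i j.
Proof.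
have stk r : i != b -> i \in k r ->
    nth B.+1 (k' r) (index i (k' r)).+1 = nth B.+1 (k r) (index i (k r)).+1.
  rewrite eq_sym => /negPf nib ir; have [e|nrs] := eqVneq r s.
    by rewrite e k's ks /= nib.
  by have [->|nrd] := eqVneq r d; rewrite ?k'd ?k'r //= nib.
have [->|nib] := eqVneq i b.
  apply/(uponP _ _ wf_reloc)/eqP => [[r]|->].
    by rewrite mem_reloc eqxx => /eqP -> ->; rewrite k'd /= eqxx nth0.
  by exists d; rewrite k'd ?mem_head //= eqxx nth0.
apply/(uponP _ _ wf_reloc)/(uponP _ _ wk) => -[r].
  by rewrite mem_reloc (negPf nib) => ir ->; exists r; rewrite ?stk.
by move=> ir ->; exists r; rewrite ?stk // mem_reloc (negPf nib).
Qed.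

End Relocation.

Section Retrieval.
Variables (k : config S) (s : 'I_S) (b : nat) (w : seq nat).
Hypotheses (wk : wf B k) (ks : k s = b :: w).
Let k' := act k (Retr s).

Let k's : k' s = w. Proof. by rewrite ffunE eqxx ks. Qed.

Let k'r r : r != s -> k' r = k r.
Proof. by rewrite ffunE => /negPf ->. Qed.

Let mem_retr r i : i \in k' r = (i != b) && (i \in k r).
Proof.
case: wk => uk disj _; have [->|nrs] := eqVneq r s.
  rewrite k's ks inE; have [->|//] := eqVneq i b.
  by have := uk s; rewrite ks => /andP[/negPf].
rewrite k'r //; have [-> /=|//] := eqVneq i b; apply/negbTE.
apply/negP => br; case/eqP: nrs; apply: disj br _.
by rewrite ks mem_head.
Qed.

Lemma mem_blocks_retr i : (i \in blocks k') = (i != b) && (i \in blocks k).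
Proof.
apply/mem_blocksP/andP => [[r]|[nib /mem_blocksP[r ir]]].
  by rewrite mem_retr => /andP[nib ir]; split=> //; apply/mem_blocksP; exists r.
by exists r; rewrite mem_retr nib.
Qed.

Lemma wf_retr : wf B k'.
Proof.
case: (wk) => uk disj lab; split=> [r|r r' i|r i].
- have [->|nrs] := eqVneq r s; last by rewrite k'r.
  by rewrite k's; have := uk s; rewrite ks => /andP[].
- by rewrite !mem_retr => /andP[_ ir] /andP[_]; apply: disj ir.
by rewrite mem_retr => /andP[_]; apply: lab.
Qed.

Lemma upon_retr i j : upon B k' i j = (i != b) && upon B k i j.
Proof.
have stk r : i != b -> i \in k r ->
    nth B.+1 (k' r) (index i (k' r)).+1 = nth B.+1 (k r) (index i (k r)).+1.
  rewrite eq_sym => /negPf nib ir; have [e|nrs] := eqVneq r s.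
    by rewrite e k's ks /= nib.
  by rewrite k'r.
apply/(uponP _ _ wf_retr)/andP => [[r]|[nib /(uponP _ _ wk)[r ir ->]]].
  rewrite mem_retr => /andP[nib ir] ->; split=> //.
  by apply/(uponP _ _ wk); exists r; rewrite ?stk.
by exists r; rewrite ?mem_retr ?nib ?stk.
Qed.

End Retrieval.

Definition upclosed k : Prop :=
  forall i i', i \in blocks k -> i <= i' -> i' <= B -> i' \in blocks k.

Lemma legal_retrP H k s : legal H k (Retr s) ->
  exists b w, [/\ k s = b :: w, b \in blocks k
                 & forall i, i \in blocks k -> b <= i].
Proof.
rewrite /legal; case ks: (k s) => [//|b w] /allP le; exists b, w; split=> //.
by apply/mem_blocksP; exists s; rewrite ks mem_head.
Qed.

Lemma legal_relocP H k s d : legal H k (Reloc s d) ->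
  exists b w, [/\ k s = b :: w, s != d & size (k d) < H].
Proof. by case/and3P=> sd; case ks: (k s) => [//|b w]; exists b, w. Qed.

Definition low H k : Prop := forall s, size (k s) <= H.

Lemma act_inv H k m : wf B k -> upclosed k -> low H k -> legal H k m ->
  [/\ wf B (act k m), upclosed (act k m) & low H (act k m)].
Proof.
case: m => [s d|s] wk ck lk.
  move=> /legal_relocP[b [w [ks sd ltH]]]; split; first exact: (wf_reloc wk ks sd).
    by move=> i i'; rewrite !(mem_blocks_reloc wk ks sd); apply: ck.
  move=> r; rewrite ffunE; case: eqP => _.
    by have := lk s; rewrite ks /=; lia.
  by case: eqP => _; rewrite ?lk // ks /= take0.
move=> /legal_retrP[b [w [ks bk minb]]]; split; first exact: (wf_retr wk ks).
  move=> i i'; rewrite !(mem_blocks_retr wk ks) => /andP[nib ik] ii' i'B.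
  by rewrite (ck i i') // andbT; have := minb _ ik; move: nib; lia.
move=> r; rewrite ffunE; case: eqP => _; last exact: lk.
by have := lk s; rewrite ks /=; lia.
Qed.

Lemma run_inv H k ms : wf B k -> upclosed k -> low H k -> valid H k ms ->
  [/\ wf B (run k ms), upclosed (run k ms) & low H (run k ms)].
Proof.
elim: ms k => [|m ms IH] k wk ck lk //= /andP[lm vm].
by have [? ? ?] := act_inv wk ck lk lm; apply: IH.
Qed.

Lemma run_cat k ms ms' : run k (ms ++ ms') = run (run k ms) ms'.
Proof. exact: foldl_cat. Qed.

Lemma valid_cat H k ms ms' :
  valid H k (ms ++ ms') = valid H k ms && valid H (run k ms) ms'.
Proof. by elim: ms k => [|m ms IH] k //=; rewrite IH andbA. Qed.

Lemma initial_upclosed H k : initial B H k -> upclosed k.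
Proof.
case=> pe _ _ i i'; rewrite !(perm_mem pe) !mem_iota; lia.
Qed.

Definition retrs (rs : seq 'I_S) : seq (move S) := [seq Retr s | s <- rs].

Lemma run_retrs H k rs : wf B k -> upclosed k -> low H k ->
  valid H k (retrs rs) -> let k' := run k (retrs rs) in
  [/\ {subset blocks k' <= blocks k},
      forall i j, upon B k' i j = upon B k i j && (i \in blocks k'),
      forall i j, upon B k i j -> i \notin blocks k' -> i < j
    & forall i j, upon B k i j -> j \in blocks k ->
        j \notin blocks k' -> i \notin blocks k'].
Proof.
elim: rs k => [|s rs IH] k wk ck lk.
  move=> _; split=> // [i j|i j u|i j u ->//].
    by case u: (upon B k i j) => //=; rewrite (upon_mem wk u).
  by rewrite (upon_mem wk u).
move=> /(@andP (legal H k (Retr s)))[lm vm].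
have [b [w [ks bk minb]]] := legal_retrP lm.
have [wk1 ck1 lk1] := act_inv wk ck lk lm.
have := IH _ wk1 ck1 lk1 vm; rewrite -[run k _]/(run (act k (Retr s)) (retrs rs)).
set k1 := act k (Retr s) in wk1 ck1 lk1 vm *; set k' := run k1 (retrs rs).
have mb i : (i \in blocks k1) = (i != b) && (i \in blocks k).
  exact: (mem_blocks_retr wk ks).
have ub i j : upon B k1 i j = (i != b) && upon B k i j.
  exact: (upon_retr wk ks).
case=> sub eqU lt down; split.
- by move=> i /sub; rewrite mb => /andP[].
- move=> i j; rewrite eqU ub; case: eqVneq => // -> /=.
  by rewrite [b \in _](contraNF (@sub b)) ?andbF // mb eqxx.
- move=> i j u ni; have [e|nib] := eqVneq i b; last by apply: lt; rewrite ?ub ?nib.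
  case: (upon_memr wk u) => [->|jk].
    by have := idx_blocks wk bk; rewrite e /idx; lia.
  rewrite e ltn_neqAle minb // andbT; have := upon_neq wk u.
  by rewrite e eq_sym.
- move=> i j u jk nj; have [->|nib] := eqVneq i b.
    by apply/negP => /sub; rewrite mb eqxx.
  have njb : j != b.
    by apply/negP => /eqP e; move: u; rewrite e (negPf (top_not_upon i wk ks)).
  by apply: down nj; rewrite ?ub ?mb ?nib ?njb.
Qed.

End Moves.

(** * Counting, heights and single turns *)

Section Counting.
Variables (B S : nat).
Implicit Types (k : config S) (s d : 'I_S) (i j b : nat).

Lemma row_sum k i : wf B k ->
  \sum_(1 <= j < B.+2 | j != i) (upon B k i j : nat) = (i \in blocks k).
Proof.
move=> wk; rewrite sum_bool ?iota_uniq //; last first.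
  by move=> j j' _ _ _ _; apply: upon_fun.
congr nat_of_bool; apply/hasP/idP => [[j _ /andP[_ /(upon_mem wk)]]//|].
case/(ex_upon wk) => j u; exists j; last by rewrite (upon_neq wk u).
by rewrite mem_index_iota; have [_] := upon_idx wk u; rewrite /idx; lia.
Qed.

Definition covered k i : bool :=
  has (fun j => upon B k j i) (index_iota 1 B.+1).

Lemma coveredP k i : wf B k ->
  reflect (exists j, upon B k j i) (covered k i).
Proof.
move=> wk; apply: (iffP hasP) => [[j _ u]|[j u]]; exists j => //.
by rewrite mem_index_iota; have [+ _] := upon_idx wk u; rewrite /idx; lia.
Qed.

Lemma covered_mem k i : wf B k -> i <= B -> covered k i -> i \in blocks k.
Proof.
by move=> wk iB /(coveredP _ wk)[j /(upon_memr wk)[e|//]]; rewrite e ltnn in iB.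
Qed.

Lemma col_sum k i : wf B k -> i <= B ->
  \sum_(1 <= j < B.+1 | j != i) (upon B k j i : nat) = covered k i.
Proof.
move=> wk iB; rewrite sum_bool ?iota_uniq //; last first.
  by move=> j j' _ _ _ _; apply: upon_inj.
congr nat_of_bool; apply: eq_has => j.
by case u: (upon B k j i); rewrite ?andbF // andbT eq_sym (upon_neq wk u).
Qed.

Lemma floor_sum k : wf B k ->
  \sum_(1 <= j < B.+1) (upon B k j B.+1 : nat) = \sum_(s < S) (k s != [::]).
Proof.
move=> wk; case: (wk) => uk disj lab.
have uE j : (upon B k j B.+1 : nat)
    = \sum_(s < S) ((k s != [::]) && (last 0 (k s) == j)).
  have lastE s : k s != [::] -> index (last 0 (k s)) (k s) = (size (k s)).-1.
    by move=> ns; rewrite -nth_last index_uniq //; case: (k s) ns.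
  have last_in s : k s != [::] -> last 0 (k s) \in k s.
    by case: (k s) => // x w _; apply: mem_last.
  rewrite sum_bool ?index_enum_uniq //; last first.
    move=> s s' _ _ _ _ /andP[ns /eqP e] /andP[ns' /eqP e'].
    by have := last_in s ns; rewrite e => js; apply: (disj _ _ _ js); rewrite -e' last_in.
  congr nat_of_bool; apply/(uponP _ _ wk)/hasP => [[s js e]|[s _ /andP[_ /andP[ns /eqP <-]]]].
    exists s; first exact: mem_index_enum.
    have ns : k s != [::] by case: (k s) js.
    rewrite ns -nth_last /=; have le : size (k s) <= (index j (k s)).+1.
      rewrite leqNgt; apply/negP => lt; have := mem_nth B.+1 lt.
      by rewrite -e => /lab; rewrite /idx ltnn andbF.
    have -> : (size (k s)).-1 = index j (k s).
      have := js; rewrite -index_mem; move: le.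
      by move: (size _) (index _ _) => n1 n2; lia.
    by rewrite nth_index.
  exists s; rewrite ?last_in // lastE // nth_default //; lia.
under eq_bigr do rewrite uE.
rewrite exchange_big; apply: eq_bigr => s _.
rewrite sum_bool ?iota_uniq //; last first.
  by move=> i i' _ _ _ _ /andP[_ /eqP <-] /andP[_ /eqP].
congr nat_of_bool; apply/hasP/idP => [[i _ /andP[_ /andP[]]]//|ns].
exists (last 0 (k s)); last by rewrite ns eqxx.
rewrite mem_index_iota; suff /lab : last 0 (k s) \in k s by rewrite /idx; lia.
by case: (k s) ns => // x w _; apply: mem_last.
Qed.

Lemma nonempty_stacks_lt k d : k d = [::] -> \sum_(s < S) (k s != [::]) < S.
Proof.
move=> kd; rewrite (bigD1 d) //= kd /= add0n.
rewrite -[X in _ < X]card_ord -sum1_card [X in _ < X](bigD1 d) //= add1n ltnS.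
by apply: leq_sum => s _; apply: leq_b1.
Qed.

Lemma nonempty_stacks_le k : \sum_(s < S) (k s != [::]) <= S.
Proof.
rewrite -[X in _ <= X]card_ord -sum1_card.
by apply: leq_sum => s _; apply: leq_b1.
Qed.

Lemma exists_empty_stack k :
  \sum_(s < S) (k s != [::]) < S -> exists d, k d = [::].
Proof.
move=> lt; case: (pickP (fun d => k d == [::])) => [d /eqP|ne]; first by exists d.
move: lt; rewrite (eq_bigr (fun=> 1)) => [|s _]; last by rewrite ne.
by rewrite sum1_card card_ord ltnn.
Qed.

Lemma heightE k s i : wf B k -> i \in k s ->
  height k i = size (k s) - index i (k s).
Proof.
move=> [_ disj _] iks; rewrite /height (big_pred1 s) // => s' /=.
by apply/idP/eqP => [|->//]; move=> /disj; apply.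
Qed.

Lemma height_upon k i j : wf B k -> j <= B -> upon B k i j ->
  height k i = (height k j).+1.
Proof.
move=> wk jB u; case: (upon_memr wk u) => [e|/mem_blocksP[s js]].
  by rewrite e ltnn in jB.
have [is_ e] := upon_index wk u jB js.
rewrite (heightE wk js) (heightE wk is_) e.
have := js; rewrite -index_mem e.
by move: (size _) (index _ _) => n1 n2; lia.
Qed.

Lemma height_bounds H k i : wf B k -> low H k -> i \in blocks k ->
  0 < height k i <= H.
Proof.
move=> wk lk /mem_blocksP[s iks]; rewrite (heightE wk iks).
have := iks; rewrite -index_mem; have := lk s.
by move: (size _) (index _ _) => n1 n2; lia.
Qed.

Lemma height_lower_bound (R : realFieldType) H k (u : nat -> R) :
    wf B k -> (forall i, i \in blocks k -> 1 <= u i <= H%:R)%R ->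
    (forall i j, upon B k i j -> (j <= B)%N -> u j + 1 <= u i)%R ->
  low H k.
Proof.
move=> wk bu su.
have le n i : height k i = n -> i \in blocks k -> (n%:R <= u i)%R.
  elim: n i => [|n IH] i hi ik.
    by rewrite (le_trans ler01) //; case/andP: (bu _ ik).
  have [j u_ij] := ex_upon wk ik.
  case: (upon_memr wk u_ij) => [e|jk].
    have -> : n = 0.
      move: u_ij => /(uponP _ _ wk)[s iks ej]; move: hi.
      rewrite (heightE wk iks).
      have : size (k s) <= (index i (k s)).+1; last by lia.
      rewrite leqNgt; apply/negP => /(mem_nth B.+1); rewrite -ej e => Fs.
      by case: wk => _ _ /(_ _ _ Fs); rewrite /idx ltnn andbF.
    by case/andP: (bu _ ik).
  have jB : j <= B by have := idx_blocks wk jk; rewrite /idx; lia.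
  apply: le_trans (su _ _ u_ij jB); rewrite -natr1 lerD2r; apply: IH => //.
  by apply: succn_inj; rewrite -hi; apply/esym/height_upon.
move=> s; case e: (k s) => [//|b w].
have bs : b \in k s by rewrite e mem_head.
have bk : b \in blocks k by apply/mem_blocksP; exists s.
rewrite -(ler_nat R) -e; have /andP[_] := bu _ bk; apply: le_trans.
by apply: le bk; rewrite (heightE wk bs) e /= eqxx subn0.
Qed.

End Counting.

Section Turns.
Variables (B S H : nat).
Implicit Types (k : config S) (tn : turn S) (s d : 'I_S) (i j : nat).

Definition mid k tn : config S :=
  if t_reloc tn is Some (s, d) then act k (Reloc s d) else k.

Definition relocates k tn i : bool :=
  if t_reloc tn is Some (s, _) then ohead (k s) == Some i else false.

Lemma run_turn k tn :
  run k (turn_moves tn) = run (mid k tn) (retrs (t_retr tn)).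
Proof. by case: tn => [[[s d]|] rs]. Qed.

Lemma valid_turn k tn : valid H k (turn_moves tn) ->
  (if t_reloc tn is Some (s, d) then legal H k (Reloc s d) else true)
  && valid H (mid k tn) (retrs (t_retr tn)).
Proof. by case: tn => [[[s d]|] rs]. Qed.

Definition floor_to_floor k tn : bool :=
  if t_reloc tn is Some (s, d) then (size (k s) == 1) && (k d == [::]) else false.

Section ValidTurn.
Variables (k : config S) (tn : turn S).
Hypotheses (wk : wf B k) (ck : upclosed B k) (lk : low H k).
Hypothesis vt : valid H k (turn_moves tn).
Let m := mid k tn.

Lemma mid_inv : [/\ wf B m, upclosed B m, low H m & blocks m =i blocks k].
Proof.
rewrite /m /mid; move: (valid_turn vt); case: (t_reloc tn) => [[s d]|] //.
case/andP=> l _; have [? ? ?] := act_inv wk ck lk l; split=> //.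
by have [b [w [ks sd _]]] := legal_relocP l; apply: mem_blocks_reloc wk ks sd.
Qed.

Lemma mid_retrs : valid H m (retrs (t_retr tn)).
Proof. by case/andP: (valid_turn vt). Qed.

Lemma relocates_uniq i i' : relocates k tn i -> relocates k tn i' -> i = i'.
Proof.
by rewrite /relocates; case: (t_reloc tn) => [[s d]|] // /eqP -> /eqP[].
Qed.

Lemma ex_relocates : t_reloc tn != None -> exists i, relocates k tn i.
Proof.
rewrite /relocates; move: (valid_turn vt); case: (t_reloc tn) => [[s d]|] //.
by case/andP=> /legal_relocP[b [w [-> _ _]]] _ _; exists b.
Qed.

Lemma upon_mid_other i j : ~~ relocates k tn i -> upon B m i j = upon B k i j.
Proof.
rewrite /relocates /m /mid; move: (valid_turn vt).
case: (t_reloc tn) => [[s d]|] // /andP[/legal_relocP[b [w [ks sd _]]] _].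
by rewrite (upon_reloc wk ks sd) ks /=; have [->|] := eqVneq i b; rewrite ?eqxx.
Qed.

Lemma relocates_top i : relocates k tn i -> i \in blocks k /\ ~~ covered B k i.
Proof.
rewrite /relocates; case: (t_reloc tn) => [[s d]|] //.
case ks: (k s) => [//|b w] /eqP[<-]; split.
  by apply/mem_blocksP; exists s; rewrite ks mem_head.
by apply/negP => /(coveredP _ wk)[j]; apply/negP/(top_not_upon _ wk ks).
Qed.

Lemma relocates_target i g : relocates k tn i -> upon B m i g ->
  [/\ ~~ covered B k g \/ g = B.+1, g \in blocks k \/ g = B.+1
    & g = B.+1 -> \sum_(s < S) (k s != [::]) < S].
Proof.
rewrite /relocates /m /mid; move: (valid_turn vt).
case: (t_reloc tn) => [[s d]|] // /andP[/legal_relocP[b [w [ks sd _]]] _].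
rewrite (upon_reloc wk ks sd) ks => /eqP[->]; rewrite eqxx => /eqP ->.
case kd: (k d) => [|g' w'] /=.
  by split; [right|right|move=> _; apply: nonempty_stacks_lt kd].
have g'k : g' \in blocks k by apply/mem_blocksP; exists d; rewrite kd mem_head.
split; [left|by left|].
  by apply/negP => /(coveredP _ wk)[j]; apply/negP/(top_not_upon _ wk kd).
by move=> e; have := idx_blocks wk g'k; rewrite e /idx ltnn andbF.
Qed.

Lemma relocates_moves i f : ~~ floor_to_floor k tn -> relocates k tn i ->
  upon B k i f -> ~~ upon B m i f.
Proof.
rewrite /floor_to_floor /relocates /m /mid; move: (valid_turn vt).
case: (t_reloc tn) => [[s d]|] // /andP[/legal_relocP[b [w [ks sd _]]] _].
rewrite (upon_reloc wk ks sd) ks => nff /eqP[<-]; rewrite eqxx => u.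
have bs : b \in k s by rewrite ks mem_head.
apply/negP => /eqP fE; case kd: (k d) fE nff => [|g w'] /= fE nff.
  move: u => /(uponP _ _ wk)[s' bs']; case: (wk) => _ disj lab.
  rewrite -(disj _ _ _ bs bs') ks fE /= eqxx /=.
  case: w ks nff => [|x w] ks //= _ e.
  have /lab : x \in k s by rewrite ks !inE eqxx orbT.
  by rewrite -e /idx ltnn andbF.
have gd : g \in k d by rewrite kd mem_head.
have gB : g <= B by case: wk => _ _ /(_ _ _ gd); rewrite /idx; lia.
rewrite fE in u; have [bd _] := upon_index wk u gB gd.
by case: wk => _ disj _; rewrite (disj _ _ _ bs bd) eqxx in sd.
Qed.

End ValidTurn.
End Turns.

(** * Decoding one turn *)

Section Decoding.
Variables (B S H : nat).
Implicit Types (k : config S) (s d : 'I_S) (i j b g : nat).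

Lemma retrieve_interval k p n : wf B k -> p + n <= B ->
    (forall i, (i \in blocks k) = (p < i <= B)) ->
    (forall i i', p < i <= p + n -> i < i' -> ~~ upon B k i' i) ->
  exists rs, let k' := run k (retrs rs) in
    [/\ valid H k (retrs rs), wf B k',
        forall i, (i \in blocks k') = (p + n < i <= B)
      & forall i j, upon B k' i j = upon B k i j && (p + n < i)].
Proof.
elim: n k p => [|n IH] k p wk leB bk free.
  exists [::]; split=> // [i|i j]; rewrite addn0 ?bk //.
  case u: (upon B k i j) => //=.
  by have := upon_mem wk u; rewrite bk => /andP[].
have pk : p.+1 \in blocks k by rewrite bk; lia.
have [s [w ks]] : exists s w, k s = p.+1 :: w.
  apply: (topP wk pk) => i; apply/negP => u.
  have := upon_mem wk u; rewrite bk => /andP[pi _].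
  move: u (upon_neq wk u); case: (ltnP p.+1 i) => [lt|le].
    by rewrite (negPf (free _ _ _ lt)) //; lia.
  by move: pi le; lia.
have l : legal H k (Retr s).
  by rewrite /legal ks; apply/allP => i; rewrite bk => /andP[].
have uE i j := upon_retr wk ks i j.
have [|//||rs [vrs wk' bk' uk']] := IH (act k (Retr s)) p.+1 (wf_retr wk ks).
- by lia.
- by move=> i; rewrite (mem_blocks_retr wk ks) bk; lia.
- move=> i i' Hi lt; rewrite uE negb_and; apply/orP; right; apply: free lt; lia.
exists (s :: rs) => /=; split=> //.
- exact/andP.
- by move=> i; rewrite bk'; lia.
by move=> i j; rewrite uk' uE; case: (upon B k i j); lia.
Qed.

Section Turn.
Variables (k : config S) (p p' : nat) (Yh Yc Z X' : nat -> nat -> bool).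
Hypotheses (wk : wf B k) (bk : forall i, (i \in blocks k) = (p < i <= B)).
Local Notation U := (upon B k).
Hypothesis hx : forall i j, idx B i -> idx B.+1 j -> j != i ->
  X' i j + Yh i j + ((i < j) && Z i j) = U i j + Yc i j.
Hypothesis yh_le1 :
  \sum_(1 <= i < B.+1) \sum_(1 <= j < B.+2 | j != i) (Yh i j : nat) <= 1.
Hypothesis yh_top : forall i, idx B i ->
  \sum_(1 <= j < B.+2 | j != i) (Yh i j : nat)
    + \sum_(1 <= j < B.+1 | j != i) (U j i : nat)
  <= \sum_(1 <= j < B.+2 | j != i) (U i j : nat).
Hypothesis yc_row : forall i, idx B i ->
  \sum_(1 <= j < B.+2 | j != i) (Yc i j : nat)
  = \sum_(1 <= j < B.+2 | j != i) (Yh i j : nat).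
Hypothesis yc_col : forall i, idx B i ->
  \sum_(1 <= j < B.+1 | j != i) (Yc j i : nat)
    + \sum_(1 <= j < B.+1 | j != i) (Yh j i : nat)
  <= \sum_(1 <= j < B.+2 | j != i) (U i j : nat).
Hypothesis yc_floor :
  \sum_(1 <= j < B.+1) (Yc j B.+1 : nat)
    + \sum_(1 <= j < B.+1) (Yh j B.+1 : nat) <= 1.
Hypothesis yc_top : forall i, idx B i ->
  \sum_(1 <= j < B.+1 | j != i) (Yc j i : nat)
    + \sum_(1 <= j < B.+1 | j != i) (U j i : nat)
  <= \sum_(1 <= j < B.+2 | j != i) (U i j : nat).
Hypothesis yc_stacks :
  \sum_(1 <= j < B.+1) (Yc j B.+1 : nat)
    + \sum_(1 <= j < B.+1) (U j B.+1 : nat) <= S.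
Hypothesis mid_low : forall k', wf B k' ->
  (forall i j, idx B i -> idx B.+1 j -> j != i ->
     upon B k' i j + Yh i j = U i j + Yc i j) -> low H k'.

Let sum_pos (n : nat) (P f : nat -> bool) j : 0 < j < n -> P j -> f j ->
  0 < \sum_(1 <= l < n | P l) (f l : nat).
Proof.
by move=> jn Pj fj; apply/sum_gt0P; exists j; rewrite mem_index_iota Pj fj.
Qed.

Let yh_yc_disj b f : idx B b -> idx B.+1 f -> f != b -> Yh b f -> Yc b f -> False.
Proof.
move=> Bb Bf nfb yh yc; have [e|fB] := eqVneq f B.+1.
  rewrite e in yh yc; move: yc_floor.
  have := @sum_pos B.+1 xpredT (fun j => Yc j B.+1) b Bb isT yc.
  have := @sum_pos B.+1 xpredT (fun j => Yh j B.+1) b Bb isT yh.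
  by move: (\sum_(_ <= _ < _) _) (\sum_(_ <= _ < _) _) => x y; lia.
have If : idx B f by move: Bf fB; rewrite /idx; lia.
have := yc_col If; rewrite row_sum //; rewrite eq_sym in nfb.
have := @sum_pos B.+1 (fun j => j != f) (fun j => Yc j f) b Bb nfb yc.
have := @sum_pos B.+1 (fun j => j != f) (fun j => Yh j f) b Bb nfb yh.
move: (\sum_(_ <= _ < _ | _) _) (\sum_(_ <= _ < _ | _) _) => x y.
by case: (_ \in _); lia.
Qed.

Let yh_uniq b f i j : idx B b -> idx B.+1 f -> f != b -> Yh b f ->
  idx B i -> idx B.+1 j -> j != i -> Yh i j -> i = b /\ j = f.
Proof.
move=> Bb Bf nfb yh Bi Bj nji yh'.
have row i0 j0 : idx B.+1 j0 -> j0 != i0 -> Yh i0 j0 ->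
    0 < \sum_(1 <= j < B.+2 | j != i0) (Yh i0 j : nat).
  move=> Bj0 n0; exact: (@sum_pos B.+2 (fun j => j != i0) _ j0).
have e : i = b.
  by apply: (sum_le1_eq yh_le1 _ _ (row i j Bj nji yh') _ _ (row b f Bf nfb yh));
     rewrite ?mem_index_iota.
split=> //; rewrite e in nji yh'.
have := yh_top Bb; rewrite [X in _ <= X]row_sum // => le.
apply: (@sum_le1_eq _ (index_iota 1 B.+2) (fun j => j != b) (fun j => Yh b j : nat));
  rewrite ?mem_index_iota ?yh ?yh' //.
move: le; move: (\sum_(_ <= _ < _ | _) _) (\sum_(_ <= _ < _ | _) _) => x y.
by case: (_ \in _); lia.
Qed.

Lemma decode_relocation : exists o, let tn := Turn o [::] in let m := mid k tn in
  [/\ if o is Some (s, d) then legal H k (Reloc s d) else true,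
      wf B m, forall i, (i \in blocks m) = (p < i <= B)
    & forall i j, idx B i -> idx B.+1 j -> j != i ->
        [/\ upon B m i j + Yh i j = U i j + Yc i j,
            Yh i j = relocates k tn i && U i j
          & Yc i j = relocates k tn i && upon B m i j]].
Proof.
case: (boolP (0 < \sum_(1 <= i < B.+1) \sum_(1 <= j < B.+2 | j != i) (Yh i j : nat))).
  case/sum_gt0P=> b [+ _] /sum_gt0P[f [+ nfb yh]].
  rewrite !mem_index_iota !ltnS => Bb Bf; rewrite lt0b in yh.
  have yhE i j : idx B i -> idx B.+1 j -> j != i ->
      Yh i j = (i == b) && (j == f).
    move=> Bi Bj nji; apply/idP/andP => [/(yh_uniq Bb Bf nfb yh Bi Bj nji)[-> ->]//|].
    by case=> /eqP -> /eqP ->.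
  have rowh i : idx B i ->
      \sum_(1 <= j < B.+2 | j != i) (Yh i j : nat) = (i == b).
    move=> Bi; rewrite sum_bool ?iota_uniq //; last first.
      move=> j j'; rewrite !mem_index_iota => Bj Bj' nj nj'.
      by rewrite !yhE // => /andP[_ /eqP ->] /andP[_ /eqP ->].
    congr nat_of_bool; apply/hasP/eqP => [[j]|->].
      by rewrite mem_index_iota => Bj /andP[nj]; rewrite yhE // => /andP[/eqP].
    by exists f; rewrite ?mem_index_iota // nfb yh.
  have := yh_top Bb; rewrite rowh // eqxx col_sum ?row_sum //; last by case/andP: Bb.
  case bb: (b \in blocks k) => //; case cb: (covered B k b) => // _.
  have [s [w ks]] : exists s w, k s = b :: w.
    apply: (topP wk bb) => i; apply/negP => u; move/negP: cb; apply.
    by apply/coveredP => //; exists i.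
  have : 0 < \sum_(1 <= j < B.+2 | j != b) (Yc b j : nat).
    by rewrite yc_row // rowh // eqxx.
  case/sum_gt0P=> g [+ ngb]; rewrite mem_index_iota ltnS lt0b => Bg yc.
  have ycE i j : idx B i -> idx B.+1 j -> j != i ->
      Yc i j = (i == b) && (j == g).
    move=> Bi Bj nji; apply/idP/andP => [yij|]; last by case=> /eqP -> /eqP ->.
    have row1 : \sum_(1 <= j < B.+2 | j != i) (Yc i j : nat) <= 1.
      by rewrite yc_row // rowh // leq_b1.
    have eib : i = b.
      have : 0 < \sum_(1 <= j < B.+2 | j != i) (Yc i j : nat).
        exact: (@sum_pos B.+2 (fun j => j != i) _ j).
      by rewrite yc_row // rowh //; case: eqP.
    split; apply/eqP => //; subst i.
    by apply: (sum_le1_eq row1); rewrite ?mem_index_iota ?yij ?yc.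
  have ubf : U b f.
    have := hx Bb Bf nfb; rewrite yh; case: (U b f) => //=.
    case ycf: (Yc b f); last by lia.
    by case: (yh_yc_disj Bb Bf nfb yh ycf).
  have ngf : g != f.
    apply/eqP => e; rewrite e in yc; exact: (yh_yc_disj Bb Bf nfb yh yc).
  have [d hd] : exists2 d, head B.+1 (k d) = g & s != d.
    have [e|gB] := eqVneq g B.+1.
      have [d kd] : exists d, k d = [::].
        apply: exists_empty_stack; rewrite -(floor_sum wk).
        apply: leq_trans yc_stacks; rewrite -add1n leq_add2r.
        by apply: (@sum_pos B.+1 xpredT (fun j => Yc j B.+1) b) => //; rewrite -e.
      exists d; first by rewrite kd.
      by apply/eqP => es; move: ks; rewrite es kd.
    have Ig : idx B g by move: Bg gB; rewrite /idx; lia.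
    have := yc_top Ig; rewrite eq_sym in ngb; rewrite col_sum ?row_sum //; last first.
      by case/andP: Ig.
    have := @sum_pos B.+1 (fun j => j != g) (fun j => Yc j g) b Bb ngb yc.
    move: (\sum_(_ <= _ < _ | _) _) => x; case gk: (g \in blocks k); last by lia.
    case cg: (covered B k g); first by lia.
    move=> _ _; have [d [w' kd]] : exists s w, k s = g :: w.
      apply: (topP wk gk) => i; apply/negP => u; move/negP: cg; apply.
      by apply/coveredP => //; exists i.
    exists d; first by rewrite kd.
    by apply: contraNN ngb => /eqP es; move: ks; rewrite es kd => -[->].
  move=> sd; exists (Some (s, d)) => /=.
  rewrite /mid /relocates /=.
  have uE i j := upon_reloc wk ks sd i j; rewrite hd in uE.
  have ub j : U b j = (j == f).
    by apply/idP/eqP => [u|->//]; apply: upon_fun u ubf.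
  have mE i j : idx B i -> idx B.+1 j -> j != i ->
      upon B (act k (Reloc s d)) i j + Yh i j = U i j + Yc i j.
    move=> Bi Bj nji; rewrite uE yhE // ycE //.
    by have [->|] := eqVneq i b; rewrite ?ub /= ?addn0 // addnC.
  have wm := wf_reloc wk ks sd; have lm := mid_low wm mE.
  split=> //.
  - apply/and3P; split=> //; first by rewrite ks.
    by have := lm d; rewrite ffunE eq_sym (negPf sd) eqxx ks /= take0.
  - by move=> i; rewrite (mem_blocks_reloc wk ks sd).
  move=> i j Bi Bj nji; split; first exact: mE.
    rewrite yhE // ks /=; have [->|] := eqVneq i b; rewrite ?eqxx ?ub //=.
    by move=> n; case: eqP => // -[e]; rewrite e eqxx in n.
  rewrite ycE // uE ks /=; have [->|] := eqVneq i b; rewrite ?eqxx //=.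
  by move=> n; case: eqP => // -[e]; rewrite e eqxx in n.
rewrite lt0n negbK => /eqP yh0.
have yhE i j : idx B i -> idx B.+1 j -> j != i -> Yh i j = false.
  move=> Bi Bj nji; apply/negP => yij.
  have : 0 < \sum_(1 <= i < B.+1) \sum_(1 <= j < B.+2 | j != i) (Yh i j : nat).
    apply/sum_gt0P; exists i; rewrite mem_index_iota; split=> //.
    exact: (@sum_pos B.+2 (fun j => j != i) _ j).
  by rewrite yh0.
have ycE i j : idx B i -> idx B.+1 j -> j != i -> Yc i j = false.
  move=> Bi Bj nji; apply/negP => yij.
  have : 0 < \sum_(1 <= j < B.+2 | j != i) (Yc i j : nat).
    exact: (@sum_pos B.+2 (fun j => j != i) _ j).
  rewrite yc_row // big1_seq // => j' /andP[nj'].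
  by rewrite mem_index_iota => Bj'; rewrite yhE.
exists None; split=> // i j Bi Bj nji.
by rewrite yhE // ycE.
Qed.

Hypotheses (pp' : p <= p') (p'B : p' <= B).
Hypothesis x'_row : forall i, idx B i ->
  \sum_(1 <= j < B.+2 | j != i) (X' i j : nat) = (p' < i).
Hypothesis x'_supported : forall i i', idx B i -> idx B i' -> i != i' ->
  X' i' i -> p' < i.

Lemma decode_turn : exists tn, let k' := run k (turn_moves tn) in
  [/\ valid H k (turn_moves tn), wf B k',
      forall i, (i \in blocks k') = (p' < i <= B)
    & forall i j, idx B i -> idx B.+1 j -> j != i ->
        [/\ X' i j = upon B k' i j,
            Yh i j = relocates k tn i && U i j,
            Yc i j = relocates k tn i && upon B (mid k tn) i j
          & i < j -> Z i j = upon B (mid k tn) i j && (i \notin blocks k')]].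
Proof.
have [o] := decode_relocation; set tn0 := Turn o [::]; set m := mid k tn0.
move=> /= [lo wm bm mE].
have xz i j : idx B i -> idx B.+1 j -> j != i ->
    X' i j + ((i < j) && Z i j) = upon B m i j.
  move=> Bi Bj nji; have [+ _ _] := mE i j Bi Bj nji; have := hx Bi Bj nji.
  move: (X' i j) (Yh i j) (Yc i j) (upon B k i j) (upon B m i j) (_ && _).
  by do 6!case.
have [|//|rs] := @retrieve_interval m p (p' - p) wm _ bm; rewrite ?subnKC //.
  move=> i i' Hi lt; apply/negP => u; have [Bi' _] := upon_idx wm u.
  have Bi : idx B i by rewrite /idx; lia.
  have nii' : i != i' by lia.
  have := xz i' i Bi' _ nii'; rewrite u ltnNge (ltnW lt) /= addn0.
  have BF : idx B.+1 i by move: Bi; rewrite /idx; lia.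
  move/(_ BF) => x'1; have : X' i' i by case: (X' i' i) x'1.
  by move/(x'_supported Bi Bi' nii'); lia.
move=> [vr wk' bk' uk']; exists (Turn o rs) => /=.
have rE : run k (turn_moves (Turn o rs)) = run m (retrs rs).
  exact: run_turn.
rewrite rE; split=> //.
  rewrite /turn_moves /= valid_cat; move: vr; rewrite /m /mid /tn0 /=.
  by case: (o) lo => [[s d]|] //= -> ->.
move=> i j Bi Bj nji; have [me yhE ycE] := mE i j Bi Bj nji.
have x'E : X' i j = upon B m i j && (p' < i).
  have := x'_row Bi; case: (ltnP p' i) => pi; rewrite ?andbT ?andbF => row.
    have : 0 < \sum_(1 <= j < B.+2 | j != i) (X' i j : nat) by rewrite row.
    case/sum_gt0P=> j0 [+ nj0 xj0]; rewrite mem_index_iota => Bj0.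
    have uj0 : upon B m i j0.
      by have := xz i j0 Bi Bj0 nj0; case: (X' i j0) xj0; case: upon; case: (_ && _).
    apply/idP/idP => [x|u].
      by have := xz i j Bi Bj nji; rewrite x; case: upon; case: (_ && _).
    by rewrite (upon_fun wm u uj0); case: (X' i j0) xj0.
  apply/negP => x; move: row.
  have := @sum_pos B.+2 (fun j => j != i) _ j Bj nji x.
  by move: (\sum_(_ <= _ < _ | _) _) => n; case: n.
split=> //.
  by rewrite uk'.
move=> lt; have := xz i j Bi Bj nji; rewrite lt /= bk' x'E.
case/andP: Bi => _ ->; rewrite andbT -leqNgt; case: (ltnP p' i) => _.
  by case: upon; case: (Z i j).
by case: upon; case: (Z i j).
Qed.

End Turn.
End Decoding.

(** * Decoding a feasible point *)

Lemma eq_bigr_nat (T : Type) (idx : T) (op : T -> T -> T) m n (P : pred nat)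
    (F G : nat -> T) :
  (forall i, m <= i < n -> P i -> F i = G i) ->
  \big[op/idx]_(m <= i < n | P i) F i = \big[op/idx]_(m <= i < n | P i) G i.
Proof.
move=> e; rewrite [LHS]big_nat_cond [RHS]big_nat_cond.
by apply: eq_bigr => i /andP[? ?]; apply: e.
Qed.

Lemma threshold (f : nat -> nat) n : (forall i, idx n i -> f i <= 1) ->
  (forall i, idx n i -> i != 1 -> f i.-1 <= f i) ->
  exists2 p, p <= n & forall i, idx n i -> f i = (p < i).
Proof.
elim: n => [|n IH] le1 mono; first by exists 0 => // i; rewrite /idx; lia.
have In : idx n.+1 n.+1 by rewrite /idx; lia.
case: (posnP (f n.+1)) => [f0|f1].
  exists n.+1 => // i Hi; rewrite ltnNge; case/andP: (Hi) => _ -> /=.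
  suff z m : m <= n -> f (n.+1 - m) = 0.
    by have := z (n.+1 - i); rewrite subKn; move: Hi; rewrite /idx; lia.
  elim: m => [|m IHm] mn; first by rewrite subn0.
  have := mono (n.+1 - m); rewrite IHm; last by lia.
  have -> : (n.+1 - m).-1 = n.+1 - m.+1 by lia.
  by rewrite /idx; lia.
have [i Hi|i Hi|p pn pE] := IH; [by apply: le1; move: Hi; rewrite /idx; lia
  |by apply: mono; move: Hi; rewrite /idx; lia|].
exists p; first by lia.
move=> i Hi; have [->|ni] := eqVneq i n.+1; last by apply: pE; move: Hi ni; rewrite /idx; lia.
by have := le1 _ In; move: pn; lia.
Qed.

Section Plans.
Variables (S : nat).
Implicit Types (c : config S) (p : seq (turn S)) (tn : turn S).

Lemma plan_moves_rcons p tn : plan_moves (rcons p tn) = plan_moves p ++ turn_moves tn.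
Proof. by rewrite /plan_moves map_rcons flatten_rcons. Qed.

Lemma state_size c p : state c p (size p) = run c (plan_moves p).
Proof. by rewrite /state take_size. Qed.

Lemma state_rcons c p tn t : t <= size p -> state c (rcons p tn) t = state c p t.
Proof. by move=> le; rewrite /state -cats1 takel_cat. Qed.

Lemma nth_turn_rcons p tn t : 0 < t <= size p -> nth_turn (rcons p tn) t = nth_turn p t.
Proof.
move=> h; rewrite /nth_turn nth_rcons; case: ifP => //.
by move: h; move: (size p) => n; lia.
Qed.

Lemma nth_turn_last p tn : nth_turn (rcons p tn) (size p).+1 = tn.
Proof. by rewrite /nth_turn /= nth_rcons ltnn eqxx. Qed.

End Plans.

Section Decode.
Variables (R : realFieldType) (B S H L T : nat) (c : config S).
Hypotheses (c_init : initial B H c) (L_gt0 : 0 < L).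
Variable v : vars R.
Hypotheses (core : core_constraints B S H L T (upon B c) v)
  (dom : relaxed_domains B H T v).

Let X i j t := xv v i j t == 1%R.
Let Yh i j t := yhat v i j t == 1%R.
Let Yc i j t := ychk v i j t == 1%R.
Let Z i j t := zv v i j t == 1%R.

Let natr_bool (r : R) : binary r -> r = ((r == 1%R) : nat)%:R%R.
Proof. by case=> ->; rewrite ?eqxx // eq_sym oner_eq0. Qed.

Let yhE i j t : idx B i -> idx B.+1 j -> j != i -> idx T t ->
  yhat v i j t = (Yh i j t : nat)%:R%R.
Proof. by move=> *; apply/natr_bool/(c_yh5 core). Qed.

Let ycE i j t : idx B i -> idx B.+1 j -> j != i -> idx T t ->
  ychk v i j t = (Yc i j t : nat)%:R%R.
Proof. by move=> *; apply/natr_bool/(c_yc6 core). Qed.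

Let zE i j t : idx B i -> idx B.+1 j -> i < j -> idx T t ->
  zv v i j t = (Z i j t : nat)%:R%R.
Proof. by move=> *; apply/natr_bool/(c_z4 core). Qed.

Let x_step i j t : idx B i -> idx B.+1 j -> j != i -> idx T t ->
  (xv v i j t + (Yh i j t)%:R + ((i < j)%N && Z i j t)%:R
   = xv v i j t.-1 + (Yc i j t)%:R)%R.
Proof.
move=> Bi Bj nji Tt; rewrite -yhE // -ycE //.
case: (ltngtP i j) nji => // [lt|lt] nji /=.
  by rewrite (c_x3 core) // -zE //; lra.
by rewrite (c_x2 core) //; lra.
Qed.

Let xE i j t : idx B i -> idx B.+1 j -> j != i -> t <= T ->
  xv v i j t = (X i j t : nat)%:R%R.
Proof.
move=> Bi Bj nji; elim: t => [|t IH] tT; apply: natr_bool.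
  by rewrite (c_x1 core) //; case: upon; [right|left].
have Tt : idx T t.+1 by rewrite /idx.
have := x_step Bi Bj nji Tt; rewrite /= IH ?(ltnW tT) //.
have /andP[] := c_x5' dom Bi Bj nji tT.
case: (X i j t) (Yh i j t.+1) (_ && _) (Yc i j t.+1) => [] [] [] [] /=;
  by move=> ? ? ?; first [left; lra | right; lra | exfalso; lra].
Qed.

Let x_eq i j t : idx B i -> idx B.+1 j -> j != i -> idx T t ->
  X i j t + Yh i j t + ((i < j) && Z i j t) = X i j t.-1 + Yc i j t.
Proof.
move=> Bi Bj nji Tt; have := x_step Bi Bj nji Tt.
have tT : t <= T by case/andP: Tt.
rewrite !xE // ?(leq_trans (leq_pred t)) // -!natrD => /eqP.
by rewrite eqr_nat => /eqP.
Qed.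

Let sumE n (P : pred nat) (f : nat -> R) (g : nat -> bool) :
  (forall j, 0 < j <= n -> P j -> f j = (g j : nat)%:R%R) ->
  (\sum_(1 <= j < n.+1 | P j) f j = (\sum_(1 <= j < n.+1 | P j) (g j : nat))%:R)%R.
Proof.
by move=> e; rewrite natr_sum; apply: eq_bigr_nat.
Qed.

Let r i t := \sum_(1 <= j < B.+2 | j != i) (X i j t : nat).
Let zeta i t := \sum_(1 <= j < B.+2 | i < j) (Z i j t : nat).

Let yc_row i t : idx B i -> idx T t ->
  \sum_(1 <= j < B.+2 | j != i) (Yc i j t : nat)
  = \sum_(1 <= j < B.+2 | j != i) (Yh i j t : nat).
Proof.
move=> Bi Tt; apply/eqP; rewrite -(eqr_nat R); apply/eqP; have := c_yc1 core Bi Tt.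
rewrite (sumE (g := fun j => Yc i j t)) => [|j Bj nj]; last exact: ycE.
by rewrite (sumE (g := fun j => Yh i j t)) => // j Bj nj; apply: yhE.
Qed.

Let r_step i t : idx B i -> idx T t -> r i t + zeta i t = r i t.-1.
Proof.
move=> Bi Tt; apply/eqP; rewrite -(eqn_add2r (\sum_(1 <= j < B.+2 | j != i) (Yc i j t : nat))).
apply/eqP; rewrite {1}yc_row // addnAC /r -!big_split /=.
have -> : zeta i t = \sum_(1 <= j < B.+2 | j != i) ((i < j) && Z i j t).
  rewrite /zeta big_mkcond [RHS]big_mkcond; apply: eq_bigr => j _.
  by case: ltngtP.
by rewrite -big_split /=; apply: eq_bigr_nat => j Bj nj; apply: x_eq.
Qed.

Let c_wf : wf B c := initial_wf c_init.

Let c_blocks i : (i \in blocks c) = (0 < i <= B).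
Proof. by case: c_init => pe _ _; rewrite (perm_mem pe) mem_iota; lia. Qed.

Let x0E i j : idx B i -> idx B.+1 j -> j != i -> X i j 0 = upon B c i j.
Proof.
move=> Bi Bj nji; rewrite /X (c_x1 core) //.
by case: upon; rewrite ?eqxx // eq_sym oner_eq0.
Qed.

Let r0 i : idx B i -> r i 0 = 1.
Proof.
move=> Bi; transitivity (nat_of_bool (i \in blocks c)); last first.
  by rewrite c_blocks -/(idx B i) Bi.
by rewrite -(row_sum _ c_wf); apply: eq_bigr_nat => j Bj nj; rewrite x0E.
Qed.

Let r_total i t : idx B i -> t <= T ->
  r i t + \sum_(1 <= tau < t.+1) zeta i tau = 1.
Proof.
move=> Bi; elim: t => [|t IH] tT; first by rewrite big_nil addn0 r0.
by rewrite big_nat_recr //= addnA addnAC r_step /idx // IH // ltnW.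
Qed.

Let zeta_sum i t : idx B i -> t <= T ->
  (\sum_(1 <= j < B.+2 | (i < j)%N) \sum_(1 <= tau < T.+1 | (tau <= t)%N) zv v i j tau
   = (\sum_(1 <= tau < t.+1) zeta i tau)%:R)%R.
Proof.
move=> Bi tT; rewrite [in RHS]exchange_big natr_sum /=.
apply: eq_bigr_nat => j Bj lt.
rewrite (sumE (g := fun tau => Z i j tau)) => [|tau Ttau _]; last exact: zE.
by congr (_%:R)%R; rewrite (big_nat_widen _ t.+1 T.+1).
Qed.

Let r_mono i t : idx B i -> i != 1 -> t <= T -> r i.-1 t <= r i t.
Proof.
move=> Bi n1 tT; case: (posnP t) => [->|t0].
  have Bi' : idx B i.-1 by move: Bi n1; rewrite /idx; lia.
  by rewrite !r0.
have Bi' : idx B i.-1 by move: Bi n1; rewrite /idx; lia.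
have := c_z3 core Bi n1 (introT andP (conj t0 tT)).
rewrite !zeta_sum // ler_nat; have := r_total Bi tT; have := r_total Bi' tT.
by move: (r _ _) (r _ _) (\sum_(_ <= _ < _) _) (\sum_(_ <= _ < _) _); lia.
Qed.

Let r_threshold t : t <= T -> exists2 q, q <= B & forall i, idx B i -> r i t = (q < i).
Proof.
move=> tT; apply: threshold => [i Bi|i Bi n1]; last exact: r_mono.
by have := r_total Bi tT; lia.
Qed.

Let r_pos i j t : idx B.+1 j -> j != i -> X i j t -> 0 < r i t.
Proof.
by move=> Bj nj x; apply/sum_gt0P; exists j; rewrite mem_index_iota nj x.
Qed.

Let yc_col i t : idx B i -> idx T t ->
  \sum_(1 <= j < B.+1 | j != i) (Yc j i t : nat)
    + \sum_(1 <= j < B.+1 | j != i) (Yh j i t : nat) <= r i t.-1.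
Proof.
move=> Bi Tt; have := c_yc2 core Bi Tt.
have BF : idx B.+1 i by move: Bi; rewrite /idx; lia.
have tT : t.-1 <= T by move: Tt; rewrite /idx; lia.
rewrite (sumE (g := fun j => Yc j i t)) => [|j Bj nj]; last by rewrite ycE // eq_sym.
rewrite (sumE (g := fun j => X i j t.-1)) => [|j Bj nj]; last by rewrite xE.
rewrite (sumE (g := fun j => Yh j i t)) => [|j Bj nj]; last by rewrite yhE // eq_sym.
by rewrite lerBrDr -natrD ler_nat.
Qed.

(* A block left upon an already retrieved one could never be lifted again, by
   [c_yc2], and hence would still be there at the end. *)
Let supported i i' t : idx B i -> idx B i' -> i != i' -> t <= T ->
  X i' i t -> 0 < r i t.
Proof.
move=> Bi Bi' nii'.
have BF : idx B.+1 i by move: Bi; rewrite /idx; lia.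
move=> tT x; rewrite lt0n; apply/negP => /eqP ri; move: x ri.
have [n] : exists n, n = T - t by exists (T - t).
elim: n t tT => [|n IH] t tT nE x ri.
  have tE : t = T by lia.
  by move: x; rewrite /X tE (c_x4 core) // eq_sym oner_eq0.
have Tt : idx T t.+1 by rewrite /idx; lia.
have [q _ rq] := r_threshold tT.
have lt : i < i'.
  have := r_pos BF nii' x; rewrite rq //; move: ri; rewrite rq //.
  by case: ltnP => // qi _; case: ltnP => // qi' _; lia.
apply: (IH t.+1); [by case/andP: Tt|by lia| |]; last first.
  by have := r_step Bi Tt; rewrite /= ri; lia.
have := yc_col Bi Tt; rewrite /= ri leqn0 addn_eq0 => /andP[_ /eqP yh0].
have := x_eq Bi' BF nii' Tt; rewrite /= x.
case yh: (Yh i' i t.+1).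
  have : 0 < \sum_(1 <= j < B.+1 | j != i) (Yh j i t.+1 : nat).
    by apply/sum_gt0P; exists i'; rewrite mem_index_iota eq_sym nii' yh.
  by rewrite yh0.
by rewrite ltnNge (ltnW lt) /=; case: (X i' i t.+1); case: (Yc i' i t.+1).
Qed.

Let yh_le1 t : idx T t ->
  \sum_(1 <= i < B.+1) \sum_(1 <= j < B.+2 | j != i) (Yh i j t : nat) <= 1.
Proof.
have e t' : idx T t' ->
    (\sum_(1 <= i < B.+1) \sum_(1 <= j < B.+2 | j != i) yhat v i j t'
     = (\sum_(1 <= i < B.+1) \sum_(1 <= j < B.+2 | j != i) (Yh i j t' : nat))%:R)%R.
  move=> Tt; rewrite natr_sum.
  apply: eq_bigr_nat => i Bi _; apply: sumE => j Bj nj; exact: yhE.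
elim: t => // t IH Tt; case: (leqP t.+1 L) => [le|lt].
  by rewrite -(ler_nat R) -e // (c_yh1 core).
have Tt' : idx T t by move: Tt lt; rewrite /idx; lia.
rewrite -(ler_nat R) -e //; apply: le_trans (c_yh2 core Tt lt) _.
by rewrite e // ler_nat IH.
Qed.

Let yh_top i t : idx B i -> idx T t ->
  \sum_(1 <= j < B.+2 | j != i) (Yh i j t : nat)
    + \sum_(1 <= j < B.+1 | j != i) (X j i t.-1 : nat) <= r i t.-1.
Proof.
move=> Bi Tt; have := c_yh4 core Bi Tt.
have BF : idx B.+1 i by move: Bi; rewrite /idx; lia.
have tT : t.-1 <= T by move: Tt; rewrite /idx; lia.
rewrite (sumE (g := fun j => Yh i j t)) => [|j Bj nj]; last by rewrite yhE.
rewrite (sumE (g := fun j => X i j t.-1)) => [|j Bj nj]; last by rewrite xE.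
rewrite (sumE (g := fun j => X j i t.-1)) => [|j Bj nj]; last by rewrite xE // eq_sym.
by rewrite lerBrDr -natrD ler_nat.
Qed.

Let yc_top i t : idx B i -> idx T t ->
  \sum_(1 <= j < B.+1 | j != i) (Yc j i t : nat)
    + \sum_(1 <= j < B.+1 | j != i) (X j i t.-1 : nat) <= r i t.-1.
Proof.
move=> Bi Tt; have := c_yc4 core Bi Tt.
have BF : idx B.+1 i by move: Bi; rewrite /idx; lia.
have tT : t.-1 <= T by move: Tt; rewrite /idx; lia.
rewrite (sumE (g := fun j => Yc j i t)) => [|j Bj nj]; last by rewrite ycE // eq_sym.
rewrite (sumE (g := fun j => X i j t.-1)) => [|j Bj nj]; last by rewrite xE.
rewrite (sumE (g := fun j => X j i t.-1)) => [|j Bj nj]; last by rewrite xE // eq_sym.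
by rewrite lerBrDr -natrD ler_nat.
Qed.

Let idxF : idx B.+1 B.+1. Proof. by rewrite /idx leqnn. Qed.

Let idx_neqF j : idx B j -> B.+1 != j.
Proof. by rewrite /idx; lia. Qed.

Let yc_floor t : idx T t ->
  \sum_(1 <= j < B.+1) (Yc j B.+1 t : nat)
    + \sum_(1 <= j < B.+1) (Yh j B.+1 t : nat) <= 1.
Proof.
move=> Tt; have := c_yc3 core Tt.
rewrite (sumE (g := fun j => Yc j B.+1 t)) => [|j Bj _]; last by rewrite ycE // idx_neqF.
rewrite (sumE (g := fun j => Yh j B.+1 t)) => [|j Bj _]; last by rewrite yhE // idx_neqF.
by move=> le; rewrite -(ler_nat R) natrD -lerBrDr.
Qed.

Let yc_stacks t : idx T t ->
  \sum_(1 <= j < B.+1) (Yc j B.+1 t : nat)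
    + \sum_(1 <= j < B.+1) (X j B.+1 t.-1 : nat) <= S.
Proof.
move=> Tt; have := c_yc5 core Tt.
have tT : t.-1 <= T by move: Tt; rewrite /idx; lia.
rewrite (sumE (g := fun j => Yc j B.+1 t)) => [|j Bj _]; last by rewrite ycE // idx_neqF.
rewrite (sumE (g := fun j => X j B.+1 t.-1)) => [|j Bj _]; last by rewrite xE // idx_neqF.
by rewrite lerBrDr -natrD ler_nat.
Qed.

Let mid_low t (k' : config S) : idx T t -> wf B k' ->
  (forall i j, idx B i -> idx B.+1 j -> j != i ->
     upon B k' i j + Yh i j t = X i j t.-1 + Yc i j t) -> low H k'.
Proof.
move=> Tt wk' uE; have tT : t.-1 <= T by move: Tt; rewrite /idx; lia.
apply: (height_lower_bound (u := uv v ^~ t) wk') => [i ik|i j u jB].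
  by apply: (c_u2' dom) => //; apply: idx_blocks wk' ik.
have [Bi BFj] := upon_idx wk' u; have nj := upon_neq wk' u.
have Bj : idx B j by move: BFj; rewrite /idx jB => /andP[->].
have := c_u1 core Bi Bj nj Tt; rewrite xE // yhE // ycE //.
have := uE i j Bi BFj nj; rewrite u.
case: (Yh i j t) (X i j t.-1) (Yc i j t) => [] [] [] //= _ h;
  by apply: le_trans h; lra.
Qed.

Let turn_encoded p t := forall i j, idx B i -> idx B.+1 j -> j != i ->
  [/\ X i j t = upon B (state c p t) i j,
      Yh i j t = lifted B c p i j t,
      Yc i j t = put_down B c p i j t
    & i < j -> Z i j t = retrieved B c p i j t].

Lemma decode_upto t : t <= T -> exists p, let k := run c (plan_moves p) in
  [/\ size p = t, valid H c (plan_moves p), wf B k,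
      exists2 q, q <= B /\ forall i, (i \in blocks k) = (q < i <= B)
        & forall i, idx B i -> r i t = (q < i)
    & (forall i j, idx B i -> idx B.+1 j -> j != i -> X i j t = upon B k i j)
      /\ forall t', idx t t' -> turn_encoded p t'].
Proof.
elim: t => [|t IH] tT.
  exists [::]; split=> //.
    by exists 0 => [|i Bi]; [split | rewrite r0 //; case/andP: Bi => ->].
  by split=> // t'; rewrite /idx; lia.
have [p [sp vp wk [q [qB bk] rk] [xk enc]]] := IH (ltnW tT).
set k := run c _ in wk bk xk.
have [q' q'B rk'] := r_threshold tT.
have Tt : idx T t.+1 by rewrite /idx.
have sumX (P : pred nat) (g : nat -> nat * nat) n :
    (forall j, 0 < j <= n -> P j -> [/\ idx B (g j).1, idx B.+1 (g j).2 & (g j).2 != (g j).1]) ->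
    \sum_(1 <= j < n.+1 | P j) (X (g j).1 (g j).2 t : nat)
    = \sum_(1 <= j < n.+1 | P j) (upon B k (g j).1 (g j).2 : nat).
  move=> h; apply: eq_bigr_nat => j Bj Pj.
  by have [? ? ?] := h j Bj Pj; rewrite xk.
have rowX i : idx B i -> r i t = \sum_(1 <= j < B.+2 | j != i) (upon B k i j : nat).
  by move=> Bi; apply: (sumX _ (fun j => (i, j))).
have colX i : idx B i -> \sum_(1 <= j < B.+1 | j != i) (X j i t : nat)
    = \sum_(1 <= j < B.+1 | j != i) (upon B k j i : nat).
  move=> Bi; apply: (sumX _ (fun j => (j, i))) => // j Bj nj; split=> //=.
    by move: Bi; rewrite /idx; lia.
  by rewrite eq_sym.
have floorX : \sum_(1 <= j < B.+1) (X j B.+1 t : nat)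
    = \sum_(1 <= j < B.+1) (upon B k j B.+1 : nat).
  by apply: (sumX _ (fun j => (j, B.+1))) => // j Bj _; split=> //=; exact: idx_neqF.
have hx i j : idx B i -> idx B.+1 j -> j != i ->
    X i j t.+1 + Yh i j t.+1 + ((i < j) && Z i j t.+1) = upon B k i j + Yc i j t.+1.
  by move=> Bi Bj nj; rewrite -xk //; apply: x_eq.
have htop i : idx B i -> _ := fun Bi => yh_top Bi Tt.
have hctop i : idx B i -> _ := fun Bi => yc_top Bi Tt.
have hcol i : idx B i -> _ := fun Bi => yc_col Bi Tt.
have hstk := yc_stacks Tt; rewrite /= floorX in hstk.
have qq' : q <= q'.
  rewrite leqNgt; apply/negP => ltq; have Bq : idx B q by rewrite /idx; lia.
  by have := r_step Bq Tt; rewrite /= (rk q Bq) (rk' q Bq) ltnn ltq.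
have [i Bi|i Bi|i Bi|k' wk' uE|i Bi|i i' Bi Bi' nii' x|] :=
  @decode_turn B S H k q q'
    (fun i j => Yh i j t.+1) (fun i j => Yc i j t.+1)
    (fun i j => Z i j t.+1) (fun i j => X i j t.+1) wk bk hx
    (yh_le1 Tt) _ (fun i Bi => yc_row Bi Tt) _ (yc_floor Tt) _ hstk _ qq' q'B.
- by have := htop i Bi; rewrite /= rowX // colX.
- by have := hcol i Bi; rewrite /= rowX.
- by have := hctop i Bi; rewrite /= rowX // colX.
- apply: (mid_low Tt wk') => i j Bi Bj nj /=; rewrite xk //; exact: uE.
- exact: rk'.
- have : 0 < r i t.+1 by apply: supported x.
  by rewrite rk' //; case: (q' < i).
move=> tn [vtn wk' bk' e]; exists (rcons p tn); rewrite plan_moves_rcons run_cat.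
split=> //.
- by rewrite size_rcons sp.
- by rewrite valid_cat vp.
- by exists q'.
split=> [i j Bi Bj nj|t' t't i j Bi Bj nj]; first by have [] := e i j Bi Bj nj.
have [le|lt] := leqP t' t.
  have It' : idx t t' by move: t't; rewrite /idx; lia.
  have := enc t' It' i j Bi Bj nj.
  rewrite /lifted /put_down /retrieved /mid_state /relocated.
  rewrite !state_rcons ?nth_turn_rcons ?sp //.
  by rewrite (leq_trans (leq_pred _)).
have -> : t' = (size p).+1 by move: t't lt; rewrite sp /idx; lia.
have [xe yhe yce ze] := e i j Bi Bj nj.
rewrite /turn_encoded /lifted /put_down /retrieved /mid_state /relocated.
have -> : state c (rcons p tn) (size p).+1 = run k (turn_moves tn).
  by rewrite -(size_rcons p tn) state_size plan_moves_rcons run_cat.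
rewrite nth_turn_last [(size p).+1.-1]/= state_rcons // state_size.
by rewrite sp; split.
Qed.

Lemma decode : exists p, encodes B T c v p /\ solves H c (plan_moves p).
Proof.
have [p [sp vp wk [q [qB bk] rk] [xk enc]]] := decode_upto (leqnn T).
exists p; split; last first.
  split=> //; apply/eqP/blocks_nilP => s; case ks: (run _ _ s) => [//|b w].
  have bb : b \in blocks (run c (plan_moves p)).
    by apply/mem_blocksP; exists s; rewrite ks mem_head.
  have Bb := idx_blocks wk bb; have [j u] := ex_upon wk bb.
  have [_ Bj] := upon_idx wk u; have nj := upon_neq wk u.
  by move: u; rewrite -xk // /X (c_x4 core) // eq_sym oner_eq0.
split=> // i j Bi Bj nj; split=> [[|t] tT|t Tt].
- by rewrite xE // x0E // /state take0.
- have [xe _ _ _] := enc t.+1 tT i j Bi Bj nj.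
  by rewrite xE // xe.
have [_ yhe yce ze] := enc t Tt i j Bi Bj nj.
split=> [||lt]; [by rewrite yhE // yhe|by rewrite ycE // yce|].
by rewrite zE // ze.
Qed.

End Decode.

(** * Constraints satisfied by a legal turn *)

Section TurnCounts.
Variables (B S H : nat) (k : config S) (tn : turn S).
Hypotheses (wk : wf B k) (ck : upclosed B k) (lk : low H k).
Hypothesis vt : valid H k (turn_moves tn).
Let m := mid k tn.
Let k' := run k (turn_moves tn).
Let rel := relocates k tn.
Let yh i j : bool := rel i && upon B k i j.
Let yc i j : bool := rel i && upon B m i j.
Let z i j : bool := upon B m i j && (i \notin blocks k').

Let wm : wf B m. Proof. by case: (mid_inv wk ck lk vt). Qed.
Let bm : blocks m =i blocks k. Proof. by case: (mid_inv wk ck lk vt). Qed.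

Let retrs_spec := let: And4 wm cm lm _ := mid_inv wk ck lk vt in
  run_retrs wm cm lm (mid_retrs vt).

Lemma turn_blocks_sub i : i \in blocks k' -> i \in blocks k.
Proof. by rewrite -bm /k' run_turn; case: retrs_spec => h _ _ _; apply: h. Qed.

Lemma upon_turn i j : upon B k' i j = upon B m i j && (i \in blocks k').
Proof. by rewrite /k' run_turn; case: retrs_spec. Qed.

Lemma retrieved_lt i j : z i j -> i < j.
Proof.
by move=> /andP[u]; rewrite /k' run_turn; case: retrs_spec => _ _ h _; apply: h.
Qed.

Lemma retrieved_above i j : upon B m i j -> j \in blocks k -> j \notin blocks k' ->
  i < j.
Proof.
rewrite -bm /k' run_turn => u jm nj; case: retrs_spec => _ _ h1 h2.
by apply: (h1 _ _ u); apply: (h2 _ _ u jm nj).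
Qed.

Lemma upon_mid_balance i j : upon B m i j + yh i j = upon B k i j + yc i j.
Proof.
rewrite /yh /yc; case r: (rel i); first by rewrite addnC.
rewrite (upon_mid_other wk vt) //; exact: negbT.
Qed.

Lemma turn_balance i j :
  upon B k' i j + yh i j + z i j = upon B k i j + yc i j.
Proof.
rewrite -upon_mid_balance upon_turn /z.
by case: upon; case: (_ \in _); rewrite ?addn0 // addnC.
Qed.

Lemma sum_relocates :
  \sum_(1 <= i < B.+1) (rel i : nat) = (t_reloc tn != None).
Proof.
rewrite sum_bool ?iota_uniq //; last by move=> i i' _ _ _ _; apply: relocates_uniq.
congr nat_of_bool; apply/hasP/idP => [[i _ /=]|/(ex_relocates vt)[i ri]].
  by rewrite /rel /relocates; case: (t_reloc tn).
exists i => //; have [ik _] := relocates_top wk ri.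
by rewrite mem_index_iota; exact: idx_blocks wk ik.
Qed.

Lemma lifted_row i : \sum_(1 <= j < B.+2 | j != i) (yh i j : nat) = rel i.
Proof.
rewrite /yh; case r: (rel i); last by rewrite big1.
by rewrite row_sum //; have [-> _] := relocates_top wk r.
Qed.

Lemma put_down_row i : \sum_(1 <= j < B.+2 | j != i) (yc i j : nat) = rel i.
Proof.
rewrite /yc; case r: (rel i); last by rewrite big1.
by rewrite row_sum // bm; have [-> _] := relocates_top wk r.
Qed.

Lemma retrieved_row i : \sum_(1 <= j < B.+2 | i < j) (z i j : nat)
  = (i \in blocks k) && (i \notin blocks k').
Proof.
transitivity (\sum_(1 <= j < B.+2 | j != i) (z i j : nat)).
  rewrite big_mkcond [RHS]big_mkcond; apply: eq_bigr => j _.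
  case zij: (z i j); last by do 2!case: ifP.
  by have lt := retrieved_lt zij; rewrite lt gtn_eqF.
rewrite /z; case: (i \notin _); last by rewrite big1 ?andbF // => j; rewrite andbF.
under eq_bigr do rewrite andbT.
by rewrite row_sum // bm andbT.
Qed.

Let yh_sum (P : pred nat) i : \sum_(1 <= j < B.+1 | P j) (yh j i : nat)
  = has (fun j => P j && yh j i) (index_iota 1 B.+1).
Proof.
rewrite sum_bool ?iota_uniq // => j j' _ _ _ _ /andP[r _] /andP[r' _].
exact: relocates_uniq r r'.
Qed.

Let yc_sum (P : pred nat) i : \sum_(1 <= j < B.+1 | P j) (yc j i : nat)
  = has (fun j => P j && yc j i) (index_iota 1 B.+1).
Proof.
rewrite sum_bool ?iota_uniq // => j j' _ _ _ _ /andP[r _] /andP[r' _].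
exact: relocates_uniq r r'.
Qed.

Lemma lift_top i : i <= B ->
  \sum_(1 <= j < B.+2 | j != i) (yh i j : nat)
    + \sum_(1 <= j < B.+1 | j != i) (upon B k j i : nat)
  <= \sum_(1 <= j < B.+2 | j != i) (upon B k i j : nat).
Proof.
move=> iB; rewrite lifted_row row_sum // col_sum //.
case r: (rel i); first by have [-> /negPf ->] := relocates_top wk r.
by case cv: (covered B k i) => //; rewrite (covered_mem wk iB cv).
Qed.

Lemma put_down_top i : i <= B ->
  \sum_(1 <= j < B.+1 | j != i) (yc j i : nat)
    + \sum_(1 <= j < B.+1 | j != i) (upon B k j i : nat)
  <= \sum_(1 <= j < B.+2 | j != i) (upon B k i j : nat).
Proof.
move=> iB; rewrite yc_sum row_sum // col_sum //.
case: hasP => [[j _ /andP[_ /andP[r u]]]|_].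
  have [[/negPf ->|e] [->|e'] _] := relocates_target wk vt r u => //.
  - by rewrite e' ltnn in iB.
  - by rewrite e ltnn in iB.
  - by rewrite e ltnn in iB.
by case cv: (covered B k i) => //; rewrite (covered_mem wk iB cv).
Qed.

Lemma put_down_stacks :
  \sum_(1 <= j < B.+1) (yc j B.+1 : nat)
    + \sum_(1 <= j < B.+1) (upon B k j B.+1 : nat) <= S.
Proof.
rewrite yc_sum floor_sum //; case: hasP => [[j _ /andP[_ /andP[r u]]]|_].
  by have [_ _ /(_ erefl)] := relocates_target wk vt r u.
exact: nonempty_stacks_le.
Qed.

Lemma retrieved_top i : idx B i ->
  \sum_(1 <= j < B.+2 | i < j) (z i j : nat)
    + \sum_(1 <= j < B.+1 | i < j) (upon B m j i : nat)
  <= \sum_(1 <= j < B.+2 | j != i) (upon B k i j : nat).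
Proof.
case/andP=> i0 iB; rewrite retrieved_row row_sum // sum_bool ?iota_uniq //; last first.
  by move=> j j' _ _ _ _; apply: upon_inj.
case: hasP => [[j _ /andP[lt u]]|_]; last by case: (_ \in _); case: (_ \notin _).
have ik : i \in blocks k.
  by rewrite -bm; case: (upon_memr wm u) => // e; rewrite e ltnn in iB.
rewrite ik /=; case: (boolP (i \in blocks k')) => //= ni.
by have := retrieved_above u ik ni; rewrite ltnNge (ltnW lt).
Qed.

Hypothesis nff : ~~ floor_to_floor k tn.

Let lift_put_disj i (P P' : pred nat) :
  has (fun j => P j && yc j i) (index_iota 1 B.+1) ->
  has (fun j => P' j && yh j i) (index_iota 1 B.+1) -> False.
Proof.
move=> /hasP[j _ /andP[_ /andP[r u]]] /hasP[j' _ /andP[_ /andP[r' u']]].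
have := relocates_moves wk vt nff r'; rewrite (relocates_uniq r' r) in u' *.
by move/(_ _ u'); rewrite u.
Qed.

Lemma put_down_moves i : i <= B ->
  \sum_(1 <= j < B.+1 | j != i) (yc j i : nat)
    + \sum_(1 <= j < B.+1 | j != i) (yh j i : nat)
  <= \sum_(1 <= j < B.+2 | j != i) (upon B k i j : nat).
Proof.
move=> iB; rewrite yc_sum yh_sum row_sum //.
case hc: (has (fun j => _ && yc _ _) _); case hh: (has _ _) => //.
- by case: (lift_put_disj hc hh).
- case/hasP: hc => j _ /andP[_ /andP[_ /(upon_memr wm)]]; rewrite bm => -[e|-> //].
  by rewrite e ltnn in iB.
- case/hasP: hh => j _ /andP[_ /andP[_ /(upon_memr wk)]] [e|-> //].
  by rewrite e ltnn in iB.
Qed.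

Lemma put_down_moves_floor :
  \sum_(1 <= j < B.+1) (yc j B.+1 : nat)
    + \sum_(1 <= j < B.+1) (yh j B.+1 : nat) <= 1.
Proof.
rewrite yc_sum yh_sum.
case hc: (has (fun j => _ && yc _ _) _); case hh: (has _ _) => //.
by case: (lift_put_disj hc hh).
Qed.

End TurnCounts.

Section ValidPlan.
Variables (B S H : nat) (c : config S) (p : seq (turn S)).
Hypotheses (c_init : initial B H c) (vp : valid H c (plan_moves p)).

Lemma split_plan t : t < size p -> plan_moves p
  = plan_moves (take t p) ++ turn_moves (nth_turn p t.+1) ++ plan_moves (drop t.+1 p).
Proof.
move=> lt; rewrite -{1}(cat_take_drop t p) (drop_nth (Turn None [::])) //.
by rewrite /plan_moves map_cat flatten_cat.
Qed.

Lemma state_step t : idx (size p) t ->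
  state c p t = run (state c p t.-1) (turn_moves (nth_turn p t)).
Proof.
case: t => // t lt; rewrite /= /state (take_nth (Turn None [::]) lt).
by rewrite plan_moves_rcons run_cat.
Qed.

Lemma valid_plan_turn t : idx (size p) t ->
  valid H (state c p t.-1) (turn_moves (nth_turn p t)).
Proof.
case: t => // t lt; move: vp; rewrite (split_plan lt) !valid_cat.
by case/and3P.
Qed.

Lemma state_inv t : [/\ wf B (state c p t), upclosed B (state c p t) & low H (state c p t)].
Proof.
apply: run_inv; [exact: initial_wf c_init|exact: initial_upclosed c_init| |].
  by case: c_init.
move: vp; rewrite -{1}(cat_take_drop t p) /plan_moves map_cat flatten_cat valid_cat.
by case/andP.
Qed.

Lemma nreloc_plan : nreloc (plan_moves p)
  = \sum_(1 <= t < (size p).+1) (t_reloc (nth_turn p t) != None).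
Proof.
have -> : nreloc (plan_moves p) = \sum_(tn <- p) (t_reloc tn != None).
  elim: (p) => [|tn q IH]; first by rewrite big_nil.
  rewrite big_cons -IH /nreloc /plan_moves /= !count_cat; congr (_ + _).
  have -> : count (@is_reloc S) [seq Retr s | s <- t_retr tn] = 0.
    by rewrite count_map; apply/eqP; rewrite -leqn0 leqNgt -has_count; apply/hasPn.
  by case: (t_reloc tn) => [[s d]|].
by rewrite (big_nth (Turn None [::])) big_add1.
Qed.

Lemma objective_encodes (R : realFieldType) (v : vars R) :
  encodes B (size p) c v p ->
  objective B (size p) v = (nreloc (plan_moves p))%:R%R.
Proof.
case=> _ enc; rewrite nreloc_plan natr_sum /objective.
transitivity (\sum_(1 <= i < B.+1) \sum_(1 <= t < (size p).+1)
  \sum_(1 <= j < B.+2 | j != i) (put_down B c p i j t : nat)%:R : R)%R.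
  apply: eq_bigr_nat => i Bi _; rewrite [RHS]exchange_big /=.
  apply: eq_bigr_nat => j Bj nj; apply: eq_bigr_nat => t Tt _.
  by have [_ /(_ t Tt)[]] := enc i j Bi Bj nj.
rewrite exchange_big /=; apply: eq_bigr_nat => t Tt _.
have [wk ck lk] := state_inv t.-1; have vt := valid_plan_turn Tt.
rewrite -(sum_relocates wk vt) natr_sum; apply: eq_bigr => i _.
by rewrite -natr_sum; congr (_%:R)%R; apply: (put_down_row wk ck lk vt).
Qed.

End ValidPlan.

(** * The feasible point of a plan *)

Section Encode.
Variables (R : realFieldType) (B S H : nat) (c : config S) (p : seq (turn S)).

Definition plan_height i t : nat :=
  if i == 1 then height c 1
  else if i \in blocks (mid_state c p t) then height (mid_state c p t) i else 1.

Definition plan_vars : vars R := Vars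
  (fun i j t => (upon B (state c p t) i j)%:R%R)
  (fun i j t => (lifted B c p i j t)%:R%R)
  (fun i j t => (put_down B c p i j t)%:R%R)
  (fun i j t => (retrieved B c p i j t)%:R%R)
  (fun i t => (plan_height i t)%:R%R).

Local Notation T := (size p).

Lemma encodes_plan_vars : encodes B T c plan_vars p.
Proof. by split. Qed.

Hypotheses (c_init : initial B H c) (vp : valid H c (plan_moves p)).
Hypothesis nff : forall t, idx T t ->
  ~~ floor_to_floor (state c p t.-1) (nth_turn p t).

Variables (j1 f1 t1 : nat).
Hypotheses (t1T : idx T t1)
  (onto1 : forall t, t < t1 -> upon B (state c p t) j1 1)
  (under1 : forall t, t < t1 -> upon B (state c p t) 1 f1)
  (height1 : forall t, 0 < t <= t1 -> height (mid_state c p t) 1 = height c 1)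
  (gone1 : forall t, t1 <= t <= T -> 1 \notin blocks (state c p t)).

Let wf_state t : wf B (state c p t). Proof. by case: (state_inv c_init vp t). Qed.
Let up_state t : upclosed B (state c p t). Proof. by case: (state_inv c_init vp t). Qed.
Let low_state t : low H (state c p t). Proof. by case: (state_inv c_init vp t). Qed.
Let v_turn t := @valid_plan_turn S H c p vp t.

Let midS t : idx T t ->
  [/\ wf B (mid_state c p t), upclosed B (mid_state c p t),
      low H (mid_state c p t) & blocks (mid_state c p t) =i blocks (state c p t.-1)].
Proof. by move=> Tt; exact: (mid_inv (wf_state _) (@up_state _) (low_state _) (v_turn Tt)). Qed.

Let c_wf : wf B c := initial_wf c_init.

Let state0 : state c p 0 = c. Proof. by rewrite /state take0. Qed.

Let c_blocks i : (i \in blocks c) = (0 < i <= B).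
Proof. by case: c_init => pe _ _; rewrite (perm_mem pe) mem_iota; lia. Qed.

Let t1_gt0 : 0 < t1. Proof. by case/andP: t1T. Qed.

Let c_f1 : upon B c 1 f1. Proof. by rewrite -state0; apply: under1. Qed.

Let B_gt0 : 0 < B.
Proof. by have := upon_mem c_wf c_f1; rewrite c_blocks; lia. Qed.

Let upon_state t i j : idx T t -> upon B (state c p t) i j
  = upon B (mid_state c p t) i j && (i \in blocks (state c p t)).
Proof.
move=> Tt; rewrite (state_step c Tt).
exact: (upon_turn (wf_state _) (@up_state _) (low_state _) (v_turn Tt)).
Qed.

Let balance t i j : idx T t ->
  upon B (state c p t) i j + lifted B c p i j t + retrieved B c p i j t
  = upon B (state c p t.-1) i j + put_down B c p i j t.
Proof.
move=> Tt; rewrite /retrieved (state_step c Tt).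
exact: (turn_balance (wf_state _) (@up_state _) (low_state _) (v_turn Tt)).
Qed.

Let mid_balance t i j : idx T t ->
  upon B (mid_state c p t) i j + lifted B c p i j t
  = upon B (state c p t.-1) i j + put_down B c p i j t.
Proof. by move=> Tt; apply: (upon_mid_balance (wf_state _) (v_turn Tt)). Qed.

Let not_retrieved_down t i j : idx T t -> j < i -> retrieved B c p i j t = false.
Proof.
move=> Tt lt; apply/negP; rewrite /retrieved (state_step c Tt).
move/(retrieved_lt (wf_state _) (@up_state _) (low_state _) (v_turn Tt)).
by rewrite ltnNge ltnW.
Qed.

Let blocks_sub t i : idx T t -> i \in blocks (state c p t) ->
  i \in blocks (state c p t.-1).
Proof.
move=> Tt; rewrite (state_step c Tt).
exact: (turn_blocks_sub (wf_state _) (@up_state _) (low_state _) (v_turn Tt)).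
Qed.

Let retrieved_upto i t : idx B i -> t <= T ->
  \sum_(1 <= j < B.+2 | i < j) \sum_(1 <= tau < T.+1 | tau <= t)
    (retrieved B c p i j tau : nat) = (i \notin blocks (state c p t)).
Proof.
move=> Bi tT; transitivity (\sum_(1 <= tau < t.+1)
   \sum_(1 <= j < B.+2 | i < j) (retrieved B c p i j tau : nat)).
  rewrite [RHS]exchange_big; apply: eq_bigr => j _.
  by rewrite [RHS](big_nat_widen _ t.+1 T.+1).
elim: t tT => [|t IH] tT.
  by rewrite big_nil state0 c_blocks -/(idx B i) Bi.
rewrite big_nat_recr //= IH ?(ltnW tT) //.
have Tt : idx T t.+1 by [].
transitivity ((i \notin blocks (state c p t))
   + ((i \in blocks (state c p t)) && (i \notin blocks (state c p t.+1)))).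
  congr (_ + _); rewrite /retrieved (state_step c Tt).
  exact: (retrieved_row (wf_state _) (@up_state _) (low_state _) (v_turn Tt)).
have := blocks_sub (i := i) Tt; rewrite /=.
by case: (i \in blocks (state c p t)); case: (i \in _) => //; move/(_ isT).
Qed.

Let mid_blocks1 t : idx T t -> 1 \in blocks (mid_state c p t) -> t <= t1.
Proof.
move=> Tt; have [_ _ _ ->] := midS Tt; rewrite leqNgt => b1; apply/negP => lt.
by move: b1; apply/negP/gone1; move: Tt lt; rewrite /idx; lia.
Qed.

Let plan_heightE t i : idx T t -> i \in blocks (mid_state c p t) ->
  plan_height i t = height (mid_state c p t) i.
Proof.
move=> Tt im; rewrite /plan_height im; case: eqP => // e; rewrite e in im *.
by rewrite height1 // mid_blocks1 // andbT; case/andP: Tt.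
Qed.

Let height_c1 : 0 < height c 1 <= H.
Proof.
apply: (height_bounds c_wf); first by case: c_init.
by rewrite c_blocks.
Qed.

Let plan_height_bounds t i : idx T t -> idx H (plan_height i t).
Proof.
move=> Tt; rewrite /plan_height; case: eqP => [_|_]; first exact: height_c1.
case: ifP => im; last by move: height_c1; rewrite /idx; lia.
by have [wm _ lm _] := midS Tt; apply: height_bounds wm lm im.
Qed.

Lemma plan_redundant : redundant_constraints B T plan_vars.
Proof.
split=> [i j t _ _ _ _|i j t _ _ _ Tt|i t Bi Tt] /=.
- by rewrite ler_nat /lifted; case: relocated; case: upon.
- have := congr1 (fun n : nat => n%:R%R : R) (mid_balance i j Tt); rewrite !natrD => mb.
  apply: le_trans (_ : (upon B (mid_state c p t) i j)%:R <= _)%R; last by lra.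
  by rewrite ler_nat /retrieved; case: upon; case: (_ \notin _).
have -> : (\sum_(1 <= j < B.+1 | (i < j)%N) ((upon B (state c p t.-1) j i)%:R
    - (lifted B c p j i t)%:R + (put_down B c p j i t)%:R)
  = \sum_(1 <= j < B.+1 | (i < j)%N) (upon B (mid_state c p t) j i)%:R :> R)%R.
  apply: eq_bigr => j _.
  have := congr1 (fun n : nat => n%:R%R : R) (mid_balance j i Tt); rewrite !natrD; lra.
rewrite -!natr_sum lerBrDr -natrD ler_nat /retrieved (state_step c Tt).
exact: (retrieved_top (wf_state _) (@up_state _) (low_state _) (v_turn Tt) Bi).
Qed.

Lemma plan_integral : integral_domains B H T plan_vars.
Proof.
split=> [i j t _ _ _ _|i t _ Tt] /=; first by case: upon; [right|left].
by exists (plan_height i t) => //; apply: plan_height_bounds.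
Qed.

Let uniq_on1 t i : t < t1 -> upon B (state c p t) i 1 = (i == j1).
Proof.
move=> lt; apply/idP/eqP => [u|->]; last exact: onto1.
exact: upon_inj (wf_state t) B_gt0 u (onto1 lt).
Qed.

Let gone_upon t i : t1 <= t <= T ->
  upon B (state c p t) i 1 = false /\ upon B (state c p t) 1 i = false.
Proof.
move=> h; have n1 := gone1 h; split; apply/negbTE/negP => u.
  by case: (upon_memr (wf_state t) u) => [[e]|b1]; [have := B_gt0; rewrite -e|rewrite b1 in n1].
by rewrite (upon_mem (wf_state t) u) in n1.
Qed.

Let relocated_not1 t : idx T t -> relocated c p t 1 = false.
Proof.
move=> Tt; apply/negP => /(relocates_top (wf_state _))[b1].
case: (leqP t t1) => [le|lt].
  case/negP; apply/coveredP => //; exists j1; apply: onto1.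
  by move: Tt le; rewrite /idx; lia.
by move=> _; move: b1; apply/negP/gone1; move: Tt lt; rewrite /idx; lia.
Qed.

Let mid_under1 t i : idx T t -> upon B (mid_state c p t) 1 i = (t <= t1) && (i == f1).
Proof.
move=> Tt; have -> : upon B (mid_state c p t) 1 i = upon B (state c p t.-1) 1 i.
  by apply: (upon_mid_other (wf_state _) (v_turn Tt)); apply/negbT/relocated_not1.
case: (leqP t t1) => [le|lt] /=.
  have lt : t.-1 < t1 by move: Tt le; rewrite /idx; lia.
  apply/idP/eqP => [u|->]; last exact: under1.
  exact: upon_fun (wf_state _) u (under1 lt).
by have [|_ ->] := @gone_upon t.-1 i; first by move: Tt lt; rewrite /idx; lia.
Qed.

Hypothesis lift_j1 : relocated c p t1 j1.

Let lifted1 t i : idx T t -> lifted B c p i 1 t = (t == t1) && (i == j1).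
Proof.
move=> Tt; case: (ltngtP t t1) => [lt|lt|e] /=.
- apply/negP => /andP[r u].
  have lt' : t.-1 < t1 := leq_ltn_trans (leq_pred t) lt.
  have e : i = j1 by apply/eqP; rewrite -(uniq_on1 _ lt').
  have := relocates_moves (wf_state _) (v_turn Tt) (nff Tt) r u.
  by have := onto1 lt; rewrite upon_state // -e => /andP[->].
- rewrite /lifted; have [|-> _] := @gone_upon t.-1 i; last by rewrite andbF.
  by move: Tt lt; rewrite /idx; lia.
rewrite e /lifted uniq_on1 ?prednK //; case: eqP => [->|_]; last by rewrite andbF.
by rewrite lift_j1.
Qed.

Let retrieved1 t i : idx T t -> retrieved B c p 1 i t = (t == t1) && (i == f1).
Proof.
move=> Tt; rewrite /retrieved mid_under1 //; case: (ltngtP t t1) => [lt|lt|e] //=.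
  by rewrite (upon_mem (wf_state t) (under1 lt)) andbF.
by rewrite gone1 ?andbT // e leqnn; case/andP: t1T.
Qed.

Let on1 t i : idx T t -> upon B (state c p t) i 1 = (t < t1) && (i == j1).
Proof.
move=> Tt; case: (ltnP t t1) => lt; first exact: uniq_on1.
by have [|-> _] := @gone_upon t i; rewrite // lt; case/andP: Tt.
Qed.

Let c_on1 i : upon B c i 1 = (i == j1).
Proof. by rewrite -state0 uniq_on1. Qed.

Let c_under1 i : upon B c 1 i = (i == f1).
Proof. by apply/idP/eqP => [u|->//]; apply: upon_fun c_wf u c_f1. Qed.

Lemma plan_block1 : block1_equalities B T (upon B c) (height c) plan_vars.
Proof.
split=> /=.
- move=> i j t Bi; rewrite c_under1 => /eqP -> Bj; rewrite c_on1 => /eqP -> Tt.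
  by rewrite lifted1 // retrieved1 // !eqxx.
- move=> i Bi; rewrite c_on1 => /eqP ->.
  rewrite (bigD1_seq t1) ?iota_uniq ?mem_index_iota //= lifted1 // !eqxx.
  rewrite big1_seq ?addr0 // => t /andP[nt]; rewrite mem_index_iota => Tt.
  by rewrite lifted1 // (negPf nt).
- move=> i t Bi n1 Tt; case y: put_down => //; exfalso.
  case/andP: y => r u; have [nc + _] := relocates_target (wf_state _) (v_turn Tt) r u.
  case=> [b1|[e]]; last by have := B_gt0; rewrite -e.
  case: nc => [/negP nc|[e]]; last by have := B_gt0; rewrite -e.
  apply: nc; apply/coveredP => //; exists j1; apply: onto1.
  rewrite ltnNge; apply/negP => le; move: b1; apply/negP/gone1.
  by rewrite le; move: Tt; rewrite /idx; lia.
- move=> i t Bi n1; rewrite c_on1 => nj Tt.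
  by rewrite on1 // lifted1 // (negPf nj) !andbF.
- move=> i t Bi n1 Tt; by rewrite /lifted /put_down relocated_not1.
- move=> i t Bi n1; rewrite c_under1 => nf Tt.
  rewrite retrieved1 // (negPf nf) andbF upon_state // mid_under1 // (negPf nf).
  by rewrite andbF.
by [].
Qed.

Variables (L K : nat).
Hypothesis solved : blocks (run c (plan_moves p)) = [::].
Hypotheses (L_gt0 : 0 < L) (LK : L <= K).
Hypothesis relK : forall t, idx T t -> (t_reloc (nth_turn p t) != None) = (t <= K).

Let lifted_total t : idx T t ->
  (\sum_(1 <= i < B.+1) \sum_(1 <= j < B.+2 | j != i) (lifted B c p i j t)%:R
   = (t <= K)%:R :> R)%R.
Proof.
move=> Tt; rewrite -relK // -(sum_relocates (wf_state _) (v_turn Tt)) natr_sum.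
apply: eq_bigr => i _; rewrite -natr_sum; congr (_%:R)%R.
exact: (lifted_row (nth_turn p t) (wf_state t.-1) i).
Qed.

Lemma plan_core : core_constraints B S H L T (upon B c) plan_vars.
Proof.
split.
- by move=> i j _ _ _ /=; rewrite state0.
- move=> i j t Bi Bj lt Tt /=.
  have := congr1 (fun n : nat => n%:R%R : R) (balance i j Tt).
  by rewrite not_retrieved_down // addn0 !natrD; lra.
- move=> i j t Bi Bj lt Tt /=.
  have := congr1 (fun n : nat => n%:R%R : R) (balance i j Tt).
  by rewrite !natrD; lra.
- move=> i j _ _ _ /=; rewrite state_size; case u: (upon _ _ _ _) => //.
  by have := @upon_mem B S _ i j (wf_state T); rewrite state_size => /(_ u); rewrite solved.
- by move=> t Tt tL /=; rewrite lifted_total // (leq_trans tL LK).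
- move=> t Tt Lt /=; rewrite lifted_total // lifted_total; last first.
    by move: Tt Lt L_gt0; rewrite /idx; lia.
  by rewrite ler_nat; case: (leqP t K) => // tK; rewrite (leq_trans (leq_pred t) tK).
- move=> i t /andP[_ iB] Tt /=; rewrite -!natr_sum lerBrDr -natrD ler_nat.
  exact: (lift_top (nth_turn p t) (wf_state t.-1) iB).
- by move=> i j t _ _ _ _ /=; case: lifted; [right|left].
- move=> i t _ Tt /=; rewrite -!natr_sum; congr (_%:R)%R.
  rewrite [RHS](lifted_row (nth_turn p t) (wf_state t.-1) i).
  exact: (put_down_row (wf_state _) (@up_state _) (low_state _) (v_turn Tt)).
- move=> i t /andP[_ iB] Tt /=; rewrite -!natr_sum lerBrDr -natrD ler_nat.
  exact: (put_down_moves (wf_state _) (@up_state _) (low_state _) (v_turn Tt) (nff Tt) iB).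
- move=> t Tt /=; rewrite -!natr_sum lerBrDr -natrD (ler_nat R _ 1).
  exact: (put_down_moves_floor (wf_state _) (v_turn Tt) (nff Tt)).
- move=> i t /andP[_ iB] Tt /=; rewrite -!natr_sum lerBrDr -natrD ler_nat.
  exact: (put_down_top (wf_state _) (v_turn Tt) iB).
- move=> t Tt /=; rewrite -!natr_sum lerBrDr -natrD ler_nat.
  exact: (put_down_stacks (wf_state _) (v_turn Tt)).
- by move=> i j t _ _ _ _ /=; case: put_down; [right|left].
- move=> i t Bi n1 Tt /=; have Bi' : idx B i.-1 by move: Bi n1; rewrite /idx; lia.
  have tT : t <= T by case/andP: Tt.
  have cnt l : idx B l ->
    (\sum_(1 <= j < B.+2 | (l < j)%N) \sum_(1 <= tau < T.+1 | (tau <= t)%N)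
      (retrieved B c p l j tau)%:R = (l \notin blocks (state c p t))%:R :> R)%R.
    move=> Bl; rewrite -retrieved_upto // natr_sum; apply: eq_bigr => j _.
    by rewrite natr_sum.
  rewrite !cnt // ler_nat; case i1: (i.-1 \in _) => /=; last by case: (_ \notin _).
  by rewrite (up_state i1) ?leq_pred //; case/andP: Bi.
- by move=> i j t _ _ _ _ /=; case: retrieved; [right|left].
move=> i j t Bi Bj nj Tt /=; have [wm _ _ _] := midS Tt.
have := congr1 (fun n : nat => n%:R%R : R) (mid_balance i j Tt); rewrite !natrD => mb.
have -> : (1 - (upon B (state c p t.-1) i j)%:R + (lifted B c p i j t)%:R
    - (put_down B c p i j t)%:R = 1 - (upon B (mid_state c p t) i j)%:R :> R)%R by lra.
case u: (upon B (mid_state c p t) i j).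
  have jB : j <= B by case/andP: Bj.
  have jm : j \in blocks (mid_state c p t).
    by case: (upon_memr wm u) => // e; move: jB; rewrite e ltnn.
  rewrite subrr mulr0 subr0 (plan_heightE Tt jm) (plan_heightE Tt (upon_mem wm u)).
  by rewrite (height_upon wm jB u) natr1.
rewrite subr0 mulr1 lerBlDr -natrD natr1 ler_nat.
by have := plan_height_bounds i Tt; have := plan_height_bounds j Tt; rewrite /idx; lia.
Qed.

End Encode.

(** * Normalizing an optimal solution *)

Section Normalization.
Variables (S H : nat).
Implicit Types (k c : config S) (s d a : 'I_S) (ms : seq (move S)).

Lemma ex_min_relocations k : solvable H k -> exists K, min_relocations H k K.
Proof.
case=> ms; have [n] : exists n, n = nreloc ms by exists (nreloc ms).
elim/ltn_ind: n ms => n IH ms nE sol.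
case: (classic (exists2 ms', solves H k ms' & nreloc ms' < n)) => [[ms' sol' lt]|no].
  exact: IH lt _ erefl sol'.
exists n, ms => //; split=> // ms' sol'; rewrite -nE leqNgt.
by apply/negP => lt; apply: no; exists ms'.
Qed.

Lemma all_blocksE (P : pred nat) k : all P (blocks k) = [forall s, all P (k s)].
Proof.
apply/allP/forallP => [h s|h i /mem_blocksP[s]].
  by apply/allP => i iks; apply: h; apply/mem_blocksP; exists s.
exact/allP/h.
Qed.

Section Swap.
Variable f : 'I_S -> 'I_S.
Hypothesis fK : involutive f.

Definition swap_config k : config S := [ffun r => k (f r)].

Definition swap_move (m : move S) : move S :=
  match m with Reloc s d => Reloc (f s) (f d) | Retr s => Retr (f s) end.

Lemma swap_act k m : act (swap_config k) (swap_move m) = swap_config (act k m).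
Proof.
by case: m => [s d|s]; apply/ffunP => r; rewrite /= !ffunE !(can2_eq fK fK) !fK ?ffunE ?fK.
Qed.

Lemma swap_legal k m : legal H k m -> legal H (swap_config k) (swap_move m).
Proof.
case: m => [s d|s] /=; rewrite !ffunE !fK; first by rewrite (can_eq fK).
case: (k s) => // b w; rewrite !all_blocksE => /forallP h.
by apply/forallP => r; rewrite ffunE.
Qed.

Lemma swap_solves k ms : solves H k ms -> solves H (swap_config k) (map swap_move ms).
Proof.
elim: ms k => [|m ms IH] k [].
  move=> _ e; split=> //; apply/eqP/blocks_nilP => s; rewrite ffunE.
  by move/eqP/blocks_nilP: e.
move=> /andP[l v] e; have [v' e'] := IH (act k m) (conj v e).
by split; rewrite /= swap_act // swap_legal.
Qed.

Lemma nreloc_swap ms : nreloc (map swap_move ms) = nreloc ms.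
Proof. by rewrite /nreloc count_map; apply: eq_count => -[]. Qed.

End Swap.

(* Moving a lone block onto an empty stack only renames two stacks. *)
Lemma optimal_not_floor_to_floor k pre s d ms :
  optimal_moves H k (pre ++ Reloc s d :: ms) ->
  ~~ ((size (run k pre s) == 1) && (run k pre d == [::])).
Proof.
case=> -[v e] opt; apply/negP => /andP[/eqP s1 /eqP d0].
move: v; rewrite valid_cat => /andP[vp /andP[/and3P[sd _ _] vms]].
set k1 := run k pre in s1 d0 vp vms.
have k1E : swap_config (tperm s d) (act k1 (Reloc s d)) = k1.
  apply/ffunP => r; rewrite !ffunE.
  have [->|ns] := eqVneq r s.
    rewrite tpermL eq_sym (negPf sd) eqxx d0 cats0.
    by case: (k1 s) s1 => [|b []].
  have [->|nd] := eqVneq r d.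
    rewrite tpermR eqxx d0.
    by case: (k1 s) s1 => [|b []].
  by rewrite tpermD ?(negPf ns) ?(negPf nd) // eq_sym.
have sol2 : solves H (act k1 (Reloc s d)) ms.
  by split=> //; move: e; rewrite run_cat.
have := swap_solves (tpermK s d) sol2; rewrite k1E => -[v' e'].
have : solves H k (pre ++ map (swap_move (tperm s d)) ms).
  by split; rewrite ?valid_cat ?vp ?run_cat.
move/opt; rewrite /nreloc !count_cat -!/(nreloc _) nreloc_swap /= leq_add2l.
by rewrite -/(nreloc _) add1n ltnn.
Qed.

Definition delete b k : config S := [ffun r => filter (predC1 b) (k r)].

Lemma delete_solves b k ms : solves H k ms ->
  exists2 ms', solves H (delete b k) ms' & nreloc ms' <= nreloc ms.
Proof.
elim: ms k => [|m ms IH] k [].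
  move=> _ e; exists [::] => //; split=> //; apply/eqP/blocks_nilP => s.
  by rewrite ffunE; move/eqP/blocks_nilP: e => ->.
move=> /andP[l v] e; have [ms' [v' e'] le] := IH (act k m) (conj v e).
case: m l v e v' e' => [s d|s] l v e v' e'.
  move: l => /and3P[sd nks ltH]; case ks: (k s) nks => [//|x w] _.
  have [exb|nxb] := eqVneq x b.
    exists ms'; last by apply: leq_trans le _; rewrite /nreloc /= leq_addl.
    suff dE : delete b (act k (Reloc s d)) = delete b k by rewrite dE in v' e'.
    apply/ffunP => r; rewrite !ffunE; have [->|_] := eqVneq r s.
      by rewrite ks /= exb eqxx.
    by case: eqP => // ->; rewrite ks /= take0 exb /= eqxx.
  have dE : delete b (act k (Reloc s d)) = act (delete b k) (Reloc s d).
    apply/ffunP => r; rewrite !ffunE; have [_|_] := eqVneq r s.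
      by rewrite ks /= nxb.
    by case: eqP => // _; rewrite ks /= take0 nxb /= take0.
  exists (Reloc s d :: ms'); last by rewrite /nreloc /= ltnS.
  rewrite dE in v' e'; split=> //; apply/andP; split=> //.
  rewrite /= sd !ffunE ks /= nxb /=.
  by apply: leq_ltn_trans ltH; rewrite size_filter count_size.
move: l => /=; case ks: (k s) => [//|x w] min.
have [exb|nxb] := eqVneq x b.
  exists ms' => //.
  suff dE : delete b (act k (Retr s)) = delete b k by rewrite dE in v' e'.
  apply/ffunP => r; rewrite !ffunE; have [->|//] := eqVneq r s.
  by rewrite ks /= exb eqxx.
have dE : delete b (act k (Retr s)) = act (delete b k) (Retr s).
  apply/ffunP => r; rewrite !ffunE; have [_|//] := eqVneq r s.
  by rewrite ks /= nxb.
exists (Retr s :: ms'); last by [].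
rewrite dE in v' e'; split=> //; apply/andP; split=> //.
rewrite /= ffunE ks /= nxb.
move: min; rewrite !all_blocksE => /forallP h; apply/forallP => r.
by rewrite ffunE all_filter; apply: sub_all (h r) => i /= ->; rewrite implybT.
Qed.

Definition relocs (rl : seq ('I_S * 'I_S)) : seq (move S) :=
  [seq Reloc x.1 x.2 | x <- rl].

(* If [1] is uncovered but not retrieved at once, the moves of the other blocks
   still work after its immediate retrieval. *)
Lemma eager_retrieval B k a w j rest ms : wf B k -> solves H k ms ->
    k a = w ++ [:: j, 1 & rest] ->
  exists rl d ms', let ms1 := relocs rl ++ [:: Reloc a d, Retr a & ms'] in
    [/\ solves H k ms1, nreloc ms1 <= nreloc ms,
        run k (relocs rl) a = [:: j, 1 & rest]
      & forall n, n <= size rl ->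
          exists w', run k (relocs (take n rl)) a = w' ++ [:: j, 1 & rest]].
Proof.
elim: ms k w => [|m ms IH] k w wk [v e] ka.
  by move/eqP/blocks_nilP: e => /(_ a); rewrite /= ka; case: (w).
have one_a : 1 \in k a by rewrite ka mem_cat !inE eqxx !orbT.
move: v => /andP[l v]; case: m l v e => [s d|s] l v e; last first.
  have [b [w' [ks bk minb]]] := legal_retrP l.
  have b1 : b = 1.
    have := minb 1; have := idx_blocks wk bk; rewrite /idx => + /(_ _).
    by case/andP=> b0 _ h; apply/eqP; rewrite eqn_leq b0 h //; apply/mem_blocksP; exists a.
  have es : s = a.
    by case: wk => _ disj _; apply: (disj _ _ 1) one_a; rewrite ks b1 mem_head.
  case: wk => /(_ a) + _ _; rewrite es b1 in ks; rewrite ks /=.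
  suff -> : 1 \in w' by [].
  by move: ka; rewrite ks; case: (w) => [[_ ->]|x w0 [_ ->]]; rewrite ?mem_cat !inE eqxx ?orbT.
have [b [w' [ks sd _]]] := legal_relocP l.
have wk1 := wf_reloc wk ks sd.
have cont w1 : act k (Reloc s d) a = w1 ++ [:: j, 1 & rest] -> exists rl d0 ms',
    let ms1 := relocs rl ++ [:: Reloc a d0, Retr a & ms'] in
    [/\ solves H k ms1, nreloc ms1 <= nreloc (Reloc s d :: ms),
        run k (relocs rl) a = [:: j, 1 & rest]
      & forall n, n <= size rl ->
          exists w', run k (relocs (take n rl)) a = w' ++ [:: j, 1 & rest]].
  move=> k1a; have [rl [d0 [ms' [[v1 e1] le ra pre]]]] := IH _ _ wk1 (conj v e) k1a.
  exists ((s, d) :: rl), d0, ms'; split=> //.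
    by split; rewrite /= ?v1 ?andbT.
  by case=> [|n]; [exists w | apply: pre].
have [es|nsa] := eqVneq s a; last first.
  have [ed|nda] := eqVneq d a.
    by apply: (cont (b :: w)); rewrite ffunE eq_sym (negPf nsa) ed eqxx ks ka /= take0.
  by apply: (cont w); rewrite ffunE eq_sym (negPf nsa) eq_sym (negPf nda).
subst s; case: w ka => [|x w] ka; last first.
  by apply: (cont w); rewrite ffunE eqxx ka.
set k1 := act k (Reloc a d) in wk1 v e cont.
have k1a : k1 a = 1 :: rest by rewrite ffunE eqxx ka.
have [ms' [v' e'] le] := delete_solves 1 (conj v e : solves H k1 ms).
have dE : delete 1 k1 = act k1 (Retr a).
  case: wk1 => uk disj _; apply/ffunP => r; rewrite [LHS]ffunE [RHS]ffunE.
  have n1 q : 1 \notin q -> [seq x <- q | predC1 1 x] = q.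
    by move=> nq; apply/all_filterP/allP => x xq /=; apply: contraNneq nq => <-.
  have [->|nra] := eqVneq r a.
    by rewrite k1a /= n1 //; have := uk a; rewrite k1a => /andP[].
  apply: n1; apply: contraNN nra => r1; apply/eqP; apply: (disj _ _ 1) r1 _.
  by rewrite k1a mem_head.
exists [::], d, ms'; split=> //.
- rewrite dE in v' e'; split=> //; apply/andP; split=> //; apply/andP; split=> //.
  rewrite -/k1 /legal k1a; apply/allP => i /(idx_blocks wk1).
  by rewrite /idx => /andP[].
- by case=> // _; exists [::].
Qed.

Lemma moves_as_turns ms : exists rs q,
  ms = retrs rs ++ plan_moves q /\ all (fun tn => t_reloc tn != None) q.
Proof.
elim: ms => [|[s d|s] ms [rs [q [-> aq]]]]; first by exists [::], [::].
  exists [::], (Turn (Some (s, d)) rs :: q); split=> //.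
by exists (s :: rs), q.
Qed.

Lemma run_blocks_sub B k ms : wf B k -> upclosed B k -> low H k -> valid H k ms ->
  {subset blocks (run k ms) <= blocks k}.
Proof.
elim: ms k => [|m ms IH] k wk ck lk; first by move=> _ i.
move=> /= /andP[l v] i.
have [wk1 ck1 lk1] := act_inv wk ck lk l.
move/(IH _ wk1 ck1 lk1 v); case: m l {wk1 ck1 lk1 v} => [s d|s] l.
  by have [b [w [ks sd _]]] := legal_relocP l; rewrite (mem_blocks_reloc wk ks sd).
have [b [w [ks _ _]]] := legal_retrP l.
by rewrite (mem_blocks_retr wk ks) => /andP[].
Qed.

End Normalization.

Lemma upon_split B S (k : config S) a w i r : wf B k -> k a = w ++ i :: r ->
  upon B k i (head B.+1 r) /\ height k i = (size r).+1.
Proof.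
move=> wk ka; have ia : i \in k a by rewrite ka mem_cat mem_head orbT.
have iE : index i (k a) = size w.
  case: (wk) => /(_ a) + _ _; rewrite ka cat_uniq /= !negb_or => /and3P[_ /andP[iw _] _].
  by rewrite index_cat (negPf iw) /= eqxx addn0.
split; last by rewrite (heightE wk ia) iE ka size_cat /= addKn.
apply/(uponP _ _ wk); exists a => //; rewrite iE ka nth_cat ltnNge leqnSn /=.
by rewrite subSnn /= nth0.
Qed.

Section EagerPlan.
Variables (B S H K T : nat) (c : config S).
Hypotheses (c_init : initial B H c) (minK : min_relocations H c K).
Hypotheses (K_gt0 : 0 < K) (KT : K <= T).

Let c_wf : wf B c := initial_wf c_init.

Let block1_buried : exists a w j rest, c a = w ++ [:: j, 1 & rest].
Proof.
case: (c_init) => pe _ nolegal.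
have B_gt0 : 0 < B.
  rewrite lt0n; apply/negP => /eqP B0; case: minK => ms [_ opt] nK.
  have sol0 : solves H c [::].
    by split=> //; apply/eqP; rewrite -size_eq0 (perm_size pe) B0.
  by have := opt _ sol0; rewrite nK leqNgt K_gt0.
have : 1 \in blocks c by rewrite (perm_mem pe) mem_iota.
case/mem_blocksP=> a one_a; case/splitPr e: {1}(c a) / one_a => [w0 rest].
case/lastP: w0 e => [|w j] e; last by exists a, w, j, rest; rewrite e cat_rcons.
case/negP: (nolegal a); rewrite /legal e /=; apply/allP => i.
by rewrite (perm_mem pe) mem_iota => /andP[].
Qed.

Lemma eager_plan : exists p j f t1,
  [/\ size p = T, solves H c (plan_moves p), nreloc (plan_moves p) = K
    & forall t, idx T t -> (t_reloc (nth_turn p t) != None) = (t <= K)] /\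
  [/\ forall t, idx T t -> ~~ floor_to_floor (state c p t.-1) (nth_turn p t),
      idx T t1 /\ relocated c p t1 j,
      forall t, t < t1 -> upon B (state c p t) j 1 /\ upon B (state c p t) 1 f,
      forall t, 0 < t <= t1 -> height (mid_state c p t) 1 = height c 1
    & forall t, t1 <= t <= T -> 1 \notin blocks (state c p t)].
Proof.
have [a [w [j [rest ca]]]] := block1_buried.
case: minK => ms0 [sol0 opt0] nK.
have [rl [d [ms' [sol le ra pre]]]] := eager_retrieval c_wf sol0 ca.
have [rs [q [e aq]]] := moves_as_turns ms'.
set ms := relocs rl ++ _ in sol le.
have opt : optimal_moves H c ms.
  by split=> // ms1 /opt0; apply: leq_trans.
have nms : nreloc ms = K.
  by apply/eqP; rewrite eqn_leq -{1}nK le /= -nK opt0.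
set none := Turn (S := S) None [::].
set first := [seq Turn (Some x) [::] | x <- rl].
set p0 := first ++ Turn (Some (a, d)) (a :: rs) :: q.
have firstE n : plan_moves (take n first) = relocs (take n rl).
  rewrite /first -map_take; elim: (take n rl) => //= -[x y] r IH.
  by rewrite /plan_moves /= -/(plan_moves _) IH.
have first_all : plan_moves first = relocs rl.
  by have := firstE (size rl); rewrite !take_oversize ?size_map.
have p0E : plan_moves p0 = ms.
  by rewrite /plan_moves map_cat flatten_cat -!/(plan_moves _) first_all /ms e /= /turn_moves /=.
have ap0 : all (fun tn => t_reloc tn != None) p0.
  by rewrite all_cat /= aq andbT all_map; apply/allP.
have sp0 : size p0 = K.
  rewrite -nms -p0E nreloc_plan big_add1 -[LHS]sum1_size (big_nth none).
  apply/esym; apply: eq_bigr_nat => t lt _; rewrite /nth_turn /=.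
  by have /all_nthP -> := ap0.
set p := p0 ++ nseq (T - K) none.
have pE : plan_moves p = ms.
  rewrite /plan_moves map_cat flatten_cat -/(plan_moves _) p0E.
  by elim: (T - K) => [|n]; rewrite /= ?cats0.
have sp : size p = T by rewrite size_cat size_nseq sp0 subnKC.
have vp : valid H c (plan_moves p) by rewrite pE; case: sol.
set t1 := (size rl).+1.
have sf : size first = size rl by rewrite size_map.
have t1K : t1 <= K by rewrite -sp0 size_cat /= sf addnS ltnS leq_addr.
have t1T : idx T t1 by rewrite /idx (leq_trans t1K).
have stateE t : t < t1 -> state c p t = run c (relocs (take t rl)).
  rewrite ltnS => tr; rewrite /state -firstE /p /p0 -catA takel_cat //.
  by rewrite sf.
have state_wf t : wf B (state c p t) by case: (state_inv c_init vp t).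
have nth1 t : 0 < t < t1 -> t_retr (nth_turn p t) = [::].
  case: t => // t lt; have tr : t < size rl by case/andP: lt.
  by rewrite /nth_turn /= /p /p0 -catA nth_cat sf tr (nth_map (a, d)).
have nth_t1 : nth_turn p t1 = Turn (Some (a, d)) (a :: rs).
  by rewrite /nth_turn /= /p /p0 -catA nth_cat sf ltnn subnn.
have st1 : state c p t1.-1 a = [:: j, 1 & rest] by rewrite stateE //= take_size.
have stT t : t < t1 -> exists w', state c p t a = w' ++ [:: j, 1 & rest].
  by move=> lt; rewrite stateE //; apply: pre.
have height_c1 : height c 1 = (size rest).+1.
  by apply: (upon_split c_wf (w := rcons w j) (a := a) _).2; rewrite cat_rcons.
exists p, j, (head B.+1 rest), t1; split; split=> //.
- by rewrite pE.
- by rewrite pE.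
- move=> t; case: t => // t lt; rewrite /nth_turn /= nth_cat sp0; case: (ltnP t K) => tK.
    by have /all_nthP -> := ap0; rewrite ?sp0.
  by rewrite nth_nseq; case: ifP.
- case=> // t lt; rewrite /floor_to_floor /=.
  case nt: (t_reloc _) => [[s d']|] //; rewrite /state.
  apply: (optimal_not_floor_to_floor (H := H) (ms :=
    retrs (t_retr (nth_turn p t.+1)) ++ plan_moves (drop t.+1 p))).
  have := split_plan (p := p) (t := t); rewrite sp => /(_ lt).
  by rewrite pE {1}/turn_moves nt => <-.
- split=> //; rewrite /relocated nth_t1 /= st1 //.
- move=> t lt; have [w' sa] := stT t lt; split.
    by have [] := upon_split (state_wf t) sa.
  have [] := @upon_split B S (state c p t) a (rcons w' j) 1 rest (state_wf t) => //.
  by rewrite cat_rcons.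
- move=> t /andP[t0 le1].
  have Tt : idx T t by rewrite /idx t0 (leq_trans le1) //; case/andP: t1T.
  have [wk ck lk] := state_inv c_init vp t.-1.
  have vt : valid H (state c p t.-1) (turn_moves (nth_turn p t)).
    by apply: valid_plan_turn; rewrite ?sp.
  have [wm _ _ _] := mid_inv wk ck lk vt.
  rewrite height_c1; have [et|nt] := eqVneq t t1.
    apply: (upon_split wm (w := [::]) (a := a) _).2.
    by rewrite et /mid nth_t1 /= ffunE eqxx -[size rl]/(t1.-1) st1.
  have lt : t < t1 by rewrite ltn_neqAle nt.
  have [w' sa] := stT t lt.
  apply: (upon_split wm (w := rcons w' j) (a := a) _).2.
  by rewrite cat_rcons -sa (@state_step S c p t) ?sp // run_turn nth1 // t0.
move=> t /andP[t1t tT]; rewrite -(subnKC t1t); move: tT; rewrite -{1}(subnKC t1t).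
elim: (t - t1) => [|n IH].
  rewrite addn0 => _; have [wk ck lk] := state_inv c_init vp t1.-1.
  have vt : valid H (state c p t1.-1) (turn_moves (nth_turn p t1)).
    by apply: valid_plan_turn; rewrite ?sp.
  have [wm cm lm _] := mid_inv wk ck lk vt.
  have ma : mid (state c p t1.-1) (nth_turn p t1) a = 1 :: rest.
    by rewrite /mid nth_t1 /= ffunE eqxx -[size rl]/(t1.-1) st1.
  have := mid_retrs vt; rewrite (@state_step S c p t1) ?sp // run_turn.
  set m := mid _ _ in wm cm lm ma *; rewrite {1 2}nth_t1 => /andP[lr vr].
  have [wk1 ck1 lk1] := act_inv wm cm lm lr.
  apply/negP => /(run_blocks_sub wk1 ck1 lk1 vr).
  by rewrite (mem_blocks_retr wm ma) eqxx.
rewrite addnS => lt; have Tt : idx T (t1 + n).+1 by [].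
have [wk ck lk] := state_inv c_init vp (t1 + n).
have vt : valid H (state c p (t1 + n)) (turn_moves (nth_turn p (t1 + n).+1)).
  by apply: (@valid_plan_turn S H c p vp (t1 + n).+1); rewrite ?sp.
apply: contra (IH (ltnW lt)); rewrite (state_step c) ?sp //.
exact: (turn_blocks_sub wk ck lk vt).
Qed.

End EagerPlan.

Local Open Scope ring_scope.

Lemma integral_relaxed (R : realFieldType) B H T (v : vars R) :
  integral_domains B H T v -> relaxed_domains B H T v.
Proof.
case=> x5 u2; split=> [i j t Bi Bj nj tT|i t Bi Tt].
  by case: (x5 i j t Bi Bj nj tT) => ->; rewrite ?lexx ?ler01.
have [k /andP[k0 kH] ->] := u2 i t Bi Tt.
by rewrite ler_nat ler1n k0.
Qed.

Theorem proposition1 (R : realFieldType) (B S H L T : nat) (c : config S)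
    (c_init : initial B H c) (c_solvable : solvable H c)
    (L_gt0 : (0 < L)%N)
    (LT_bounds : forall K, min_relocations H c K -> (L <= K <= T)%N) :
  let m3 := @brp_m3 R B S H L T (upon B c) in
  let m3' := @brp_m3_simplified R B S H L T (upon B c) (height c) in
  let obj := @objective R B T in
  exists K : nat,
    [/\ min_relocations H c K,
        optimal_value m3 obj K%:R,
        optimal_value m3' obj K%:R
      & forall v, optimal_for m3' obj v ->
          exists2 p, encodes B T c v p & optimal_moves H c (plan_moves p)].
Proof.
move=> m3 m3' obj.
have [K minK] := ex_min_relocations c_solvable.
have /andP[LK KT] := LT_bounds K minK.
have K_gt0 : (0 < K)%N := leq_trans L_gt0 LK.
have [ms [sol opt] nK] := minK.
have decoded v : core_constraints B S H L T (upon B c) v -> relaxed_domains B H T v ->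
    exists2 p, encodes B T c v p & solves H c (plan_moves p) /\ obj v = (nreloc (plan_moves p))%:R.
  move=> core dom; have [p [enc solp]] := decode c_init L_gt0 core dom.
  exists p => //; split=> //; case: (enc) => sp _; rewrite /obj; subst T.
  by apply: (objective_encodes c_init _ enc); case: solp.
have lower v : core_constraints B S H L T (upon B c) v -> relaxed_domains B H T v ->
    K%:R <= obj v.
  move=> core dom; have [p _ [solp ->]] := decoded v core dom.
  by rewrite ler_nat -nK; apply: opt.
have [p [j [f [t1 [[sp [vp solved] np relK] [nff [t1T lift_j] on1 h1 gone]]]]]] :=
  eager_plan c_init minK K_gt0 KT.
pose v := plan_vars R B c p.
have enc : encodes B T c v p by rewrite -sp; apply: encodes_plan_vars.
have obj_v : obj v = K%:R.
  by rewrite -np /obj; move: enc; rewrite -sp; apply: (objective_encodes c_init).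
have on1l t lt := (on1 t lt).1; have on1r t lt := (on1 t lt).2.
have feasible : [/\ core_constraints B S H L T (upon B c) v,
    redundant_constraints B T v, integral_domains B H T v
    & block1_equalities B T (upon B c) (height c) v].
  subst T; split.
  - by apply: plan_core; eassumption.
  - by apply: plan_redundant; eassumption.
  - by apply: plan_integral; eassumption.
  by apply: plan_block1; eassumption.
have [core red int b1] := feasible.
exists K; split=> //.
- by exists v => //; split=> // w [corew _ intw]; rewrite obj_v; apply/lower/integral_relaxed.
- exists v => //; split=> [|w [corew domw _]]; first by split=> //; apply: integral_relaxed.
  by rewrite obj_v; apply: lower.
move=> w [[corew domw _] optw]; have [q encq [solq objq]] := decoded w corew domw.
exists q => //; split=> // ms' /opt; apply: leq_trans.
rewrite nK -(ler_nat R) -objq -obj_v; apply: optw.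
by split=> //; apply: integral_relaxed.
Qed.
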